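(* Let $\mathcal{H}$ be a hypergraph with $n\ge 2$ vertices, $m$ edges and minimum degree at least $\delta$, where $\delta$ is a positive integer with $\delta\ge\max\{n,\frac{m+10}{4}\}$. Let $I(\mathcal{H})$ be the incidence graph of $\mathcal{H}$, with parts $X=V(\mathcal{H})$ and $Y=E(\mathcal{H})$, and suppose that for every $A\subseteq X$ with $|A|\ge 3$ both of the following hold in $G=I(\mathcal{H})$: (i) $|\widehat{N}(A)|\ge |A|$, and (ii) the induced subgraph $G[A\cup\widehat{N}(A)]$ is $2$-connected. Then $\mathcal{H}$ is super-pancyclic.
   Context: A (finite) hypergraph $\mathcal{H}$ consists of a vertex set $V(\mathcal{H})$ and a set of edges $E(\mathcal{H})$, each edge being a subset of $V(\mathcal{H})$ (of any size). The degree of a vertex is the number of edges containing it. A Berge cycle of length $\ell$ in $\mathcal{H}$ is a set of $\ell$ distinct vertices $\{v_1,\dots,v_\ell\}$ and $\ell$ distinct edges $\{e_1,\dots,e_\ell\}$ such that $v_i,v_{i+1}\in e_i$ for every $i\in\{1,\dots,\ell\}$ (indices modulo $\ell$); $v_1,\dots,v_\ell$ are its base vertices. $\mathcal{H}$ is super-pancyclic if for every $A\subseteq V(\mathcal{H})$ with $|A|\ge 3$, $\mathcal{H}$ has a Berge cycle whose set of base vertices is $A$. The incidence graph $I(\mathcal{H})$ is the bipartite graph with parts $X=V(\mathcal{H})$ and $Y=E(\mathcal{H})$ in which $v\in X$ and $e\in Y$ are adjacent if and only if $v\in e$. In a bipartite graph with parts $(X,Y)$, $N(v)$ denotes the set of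 neighbors of $v$, and for $A\subseteq X$ the super-neighborhood is $\widehat{N}(A)=\{y\in Y:|N(y)\cap A|\ge 2\}$. *)

(* Defs.v *)
From mathcomp Require Import all_boot all_order all_algebra.

Set Implicit Arguments.
Unset Strict Implicit.
Unset Printing Implicit Defensive.

(* The edges form a set: no repeated edges, but an edge may have any size,
   including 0 and 1. *)
Definition hypergraph (V : finType) := {set {set V}}.

Section Hypergraphs.

Variables (V : finType) (H : hypergraph V).

Definition degree (v : V) : nat := #|[set e in H | v \in e]|.

(* [ordS] is the successor modulo [l]. *)
Definition berge_cycle (l : nat) (v : 'I_l -> V) (e : 'I_l -> {set V}) : Prop :=
  [/\ injective v, injective e, forall i, e i \in H
    & forall i, (v i \in e i) && (v (ordS i) \in e i)].

Definition super_pancyclic : Prop :=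
  forall A : {set V}, 3 <= #|A| ->
  exists (l : nat) (v : 'I_l -> V) (e : 'I_l -> {set V}),
    berge_cycle v e /\ [set v i | i : 'I_l] = A.

Definition edge_type := {e : {set V} | e \in H}.

Definition incidence_vertex : finType := (V + edge_type)%type.

Definition incidence_graph : rel incidence_vertex :=
  fun a b => match a, b with
             | inl v, inr e => v \in val e
             | inr e, inl v => v \in val e
             | _, _ => false
             end.

Definition incidence_X : {set incidence_vertex} := [set inl v | v : V].

Definition incidence_Y : {set incidence_vertex} := [set inr e | e : edge_type].

End Hypergraphs.

Arguments incidence_graph {V} H.

(* A graph is given by its adjacency relation on a finite type of vertices. *)
Section Graphs.

Variables (T : finType) (G : rel T).

Definition neighbors (x : T) : {set T} := [set y | G x y].

(* [Y] is the part of the bipartite graph [G] opposite to the one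
   containing [A]. *)
Definition super_neighborhood (Y A : {set T}) : {set T} :=
  [set y in Y | 2 <= #|neighbors y :&: A|].

Definition induced (S : {set T}) : rel {x : T | x \in S} :=
  fun x y => G (val x) (val y).

Definition connected : Prop := 0 < #|T| /\ forall x y : T, connect G x y.

End Graphs.

Arguments induced {T} G S.

Definition k_connected (k : nat) (T : finType) (G : rel T) : Prop :=
  k < #|T| /\ forall W : {set T}, #|W| < k -> connected (induced G (~: W)).

(* Main.v *)
Require Import Defs.
From mathcomp Require Import all_boot all_order all_algebra.
From mathcomp Require Import zify.

(* Take a smallest vertex set X carrying no Berge cycle, with |X| = K + 1 >= 4
   (triples are handled by Hall's theorem).  By minimality every z in X is missed
   by a cycle through the rest of X; let F be its set of K edges.  If two vertices
   are the ends of a Berge path through X with edge set F, they share no edge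
   outside F.  As |E(H)| <= 4 delta - 10 and delta > K, a family of four or more
   vertices that are pairwise joined in this way must have many incidences with F.
   If z lies on at least four edges of F, rotations and crossings produce families
   that are too large for this count, except when z lies on all edges of F but at
   most one; then condition (i) fails for X or for X minus a vertex.  Otherwise z
   lies on at most three edges of F for every z and F, and the same count shows that
   z reaches the rest of X through at most three edges, up to at most one exceptional
   vertex.  Choosing four vertices so that none is exceptional for an earlier one
   gives |E(H)| >= 4 delta - 9. *)

Set Implicit Arguments.
Unset Strict Implicit.
Unset Printing Implicit Defensive.

(** The counting needs all pairs of a family to share no edge outside one and the same [F]. Hence
    paths are recorded only by their ends and their edge set: every rotation or crossing that keeps
    [F] enlarges the family, and each member [v] then has at least [delta - deg F v] edges outside
    [F] to itself. The obstacle is a vertex attached to the cycle from outside [F], since the edge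
    set then varies with the pair; the count is made with a part of [F] that all these paths keep.
    In the final count it is essential that the edges through which [z] is reached form one set,
    independent of the vertex reached: [N z] then meets even a union of neighbourhoods in at most
    three edges. Condition (ii) enters by deleting one node from the graph of a triple; this yields
    the two-set conditions of Hall's theorem and, later, at least two edges through which [z] is
    reached. The constant 10 is exhausted twice: in [4 * delta - 9] against [4 * delta - 10], and
    for [K = d + 2], where a degree sum is at least [d ^ 2 + 3] but at most [d ^ 2 + 2]. *)

(** * Index intervals and averaging over pairs *)

Lemma index_iota_cat i j l :
  i <= j <= l -> index_iota i l = index_iota i j ++ index_iota j l.
Proof.
case/andP=> ij jl; rewrite /index_iota.
have -> : l - i = (j - i) + (l - j) by lia.
by rewrite iotaD subnKC.
Qed.

Lemma index_iota_ltn i j : i < j -> index_iota i j = i :: index_iota i.+1 j.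
Proof. by move=> ij; rewrite (@index_iota_cat i i.+1) ?leqnSn // /index_iota subSnn. Qed.

Lemma index_iota1 i : index_iota i i.+1 = [:: i].
Proof. by rewrite /index_iota subSnn. Qed.

Lemma map_iotaS T (f : nat -> T) n :
  map f (iota 0 n.+1) = f 0 :: map (fun i => f i.+1) (iota 0 n).
Proof. by rewrite /= (iotaDl 1 0) -map_comp. Qed.

Lemma perm_map_periodic (T : eqType) (f : nat -> T) n :
  (forall i, f (i + n) = f i) ->
  forall s, perm_eq (map f (index_iota s (s + n))) (map f (iota 0 n)).
Proof.
move=> per; elim=> [|s IH]; first by rewrite /index_iota subn0.
case: n per IH => [|n] per IH; first by rewrite addn0 /index_iota subnn.
apply: perm_trans IH.
rewrite (@index_iota_ltn s) /=; last by lia.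
rewrite (@index_iota_cat s.+1 (s + n.+1)); last by lia.
by rewrite addSn index_iota1 map_cat /= per perm_catC.
Qed.

Lemma uniq_iota_inj (T : eqType) (f : nat -> T) n i j :
  uniq (map f (index_iota 0 n)) -> i < n -> j < n -> f i = f j -> i = j.
Proof. by rewrite /index_iota subn0 => /mkseq_uniqP inj; apply: inj. Qed.

Ltac perm_count := apply/permP => ?; repeat rewrite /= ?map_cat ?count_cat; clear; lia.

Lemma perm_enum_set (T : finType) (s : seq T) :
  uniq s -> perm_eq s (enum [set x in s]).
Proof. by move=> us; apply: uniq_perm; rewrite ?enum_uniq // => x; rewrite mem_enum inE. Qed.

(** At most one value exceeds [s / 2]; it is summed together with one partner, and every remaining
    term is at most [s / 2]. *)
Lemma sum_pair_bound (T : finType) (P : {set T}) (f : T -> nat) s :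
    2 <= #|P| -> (forall p q, p \in P -> q \in P -> p != q -> f p + f q <= s) ->
  2 * \sum_(p in P) f p <= #|P| * s.
Proof.
move=> P2 H.
have bnd (Q : {set T}) : Q \subset P -> (forall p, p \in Q -> 2 * f p <= s) ->
    2 * \sum_(p in Q) f p <= #|Q| * s.
  by move=> QP HQ; rewrite big_distrr -sum_nat_const; apply: leq_sum.
case: (pickP [pred p in P | s < 2 * f p]) => [p /andP[pP pb]|none]; last first.
  by apply: bnd => // p pP; have := none p; rewrite /= pP /=; clear; lia.
have [q qP] : exists q, q \in P :\ p.
  by apply/set0Pn; rewrite -card_gt0; have := cardsD1 p P; rewrite pP; move: P2; clear; lia.
have /setD1P[qp qP'] := qP.
rewrite (big_setD1 p) //= (big_setD1 q) //=.
have := cardsD1 p P; have := cardsD1 q (P :\ p); rewrite pP qP => -> ->.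
have := H _ _ pP qP'; rewrite eq_sym => /(_ qp).
have : 2 * \sum_(i in P :\ p :\ q) f i <= #|P :\ p :\ q| * s.
  apply: bnd; first by apply/subsetP => i /setD1P[_ /setD1P[]].
  move=> i /setD1P[_ /setD1P[ip iP]]; have := H _ _ iP pP ip.
  by move: pb; clear; lia.
by clear; lia.
Qed.

(** * Berge walks *)

Section Walks.

Variables (V E : finType) (N : V -> {set E}).

(* Vertex and edge lists only matter up to permutation. *)
Inductive walk : V -> V -> seq V -> seq E -> Prop :=
| walk_nil a : walk a a [:: a] [::]
| walk_cons a b c e vs es vs' es' :
    e \in N a -> e \in N b -> walk b c vs es ->
    perm_eq vs' (a :: vs) -> perm_eq es' (e :: es) -> walk a c vs' es'.

Lemma walk_perm a b vs es vs' es' : walk a b vs es ->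
  perm_eq vs' vs -> perm_eq es' es -> walk a b vs' es'.
Proof.
case=> [c|c d f e ws fs ws' fs' ec ed W pv pe] pv' pe'.
  by rewrite (perm_small_eq _ pv') // (perm_small_eq _ pe') //; exact: walk_nil.
by apply: walk_cons ec ed W _ _; [apply: perm_trans pv' pv | apply: perm_trans pe' pe].
Qed.

Lemma walk_cat a b c d e vs es vs' es' :
  walk a b vs es -> walk c d vs' es' -> e \in N b -> e \in N c ->
  walk a d (vs ++ vs') (e :: es ++ es').
Proof.
move=> W W'; elim: W => {a b vs es} [a|a b f g vs es ws fs ga gb W IH pv pe] eb ec.
  exact: (walk_cons eb ec W').
apply: (walk_cons ga gb (IH eb ec)).
  by rewrite -cat_cons perm_cat2r.
apply: (@perm_trans _ (e :: (g :: es) ++ es')).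
  by rewrite perm_cons perm_cat2r.
by apply/permP => P /=; lia.
Qed.

Lemma walk_rev a b vs es : walk a b vs es -> walk b a vs es.
Proof.
elim=> {a b vs es} [a|a b f g vs es ws fs ga gb W IH pv pe]; first exact: walk_nil.
apply: walk_perm (walk_cat IH (walk_nil a) gb ga) _ _.
  by rewrite cats1 perm_sym perm_rcons perm_sym.
by rewrite cats0.
Qed.

Lemma walk_seg (u : nat -> V) (w : nat -> E) i j : i <= j ->
  (forall l, i <= l < j -> (w l \in N (u l)) && (w l \in N (u l.+1))) ->
  walk (u i) (u j) (map u (index_iota i j.+1)) (map w (index_iota i j)).
Proof.
move=> ij; have -> : j = i + (j - i) by lia.
elim: (j - i) => {j ij} [|n IH] L.
  by rewrite addn0 index_iota1 /index_iota subnn; exact: walk_nil.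
have W : walk (u i) (u (i + n)) (map u (index_iota i (i + n).+1)) (map w (index_iota i (i + n))).
  by apply: IH => l Hl; apply: L; lia.
have /andP[l1 l2] : (w (i + n) \in N (u (i + n))) && (w (i + n) \in N (u (i + n).+1)).
  by apply: L; lia.
rewrite addnS.
apply: walk_perm (walk_cat W (walk_nil (u (i + n).+1)) l1 l2) _ _.
  by rewrite (@index_iota_cat i (i + n).+1) ?map_cat ?index_iota1 //; lia.
rewrite (@index_iota_cat i (i + n)); last by lia.
by rewrite index_iota1 map_cat cats0 cats1 perm_rcons.
Qed.

(** Makes the order along the walk explicit again; [e0] is a default value for the edge function. *)
Lemma walk_index (e0 : E) a b vs es : walk a b vs es ->
  exists (u : nat -> V) (w : nat -> E),
  [/\ u 0 = a, u (size es) = b,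
      forall l, l < size es -> (w l \in N (u l)) && (w l \in N (u l.+1)),
      perm_eq vs (map u (iota 0 (size es).+1))
    & perm_eq es (map w (iota 0 (size es)))].
Proof.
elim=> {a b vs es} [a|a b c e vs es vs' es' ea eb W [u [w [u0 un L pv pe]]] pv' pe'].
  by exists (fun=> a), (fun=> e0); split.
have sz : size es' = (size es).+1 by rewrite (perm_size pe').
exists (fun i => if i is j.+1 then u j else a), (fun i => if i is j.+1 then w j else e).
rewrite sz; split=> //.
- by case=> [|l] Hl; [rewrite ea u0 eb | apply: L].
- by apply: perm_trans pv' _; rewrite map_iotaS perm_cons.
- by apply: perm_trans pe' _; rewrite map_iotaS perm_cons.
Qed.

Lemma walk_edges a b vs es e : walk a b vs es -> e \in es -> exists v, e \in N v.
Proof.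
elim=> {a b vs es} // a b c f vs es vs' es' fa _ _ IH _ pe.
by rewrite (perm_mem pe) inE => /orP[/eqP->|/IH //]; exists a.
Qed.

Lemma walk_ends a b vs es : walk a b vs es -> (a \in vs) && (b \in vs).
Proof.
elim=> {a b vs es} [a|a b c f vs es vs' es' _ _ _ /andP[_ cv] pv _]; first by rewrite inE eqxx.
by rewrite !(perm_mem pv) !inE eqxx cv orbT.
Qed.

Lemma walk_size a b vs es : walk a b vs es -> size vs = (size es).+1.
Proof.
elim=> {a b vs es} // a b c f vs es vs' es' _ _ _ IH pv pe.
by rewrite (perm_size pv) (perm_size pe) /= IH.
Qed.

(** * Rotations and crossings of a path that keep its edge set *)

Section Crossing.

Variables (u : nat -> V) (w : nat -> E) (K : nat).
Hypothesis links : forall l, l < K -> (w l \in N (u l)) && (w l \in N (u l.+1)).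

Let seg i j : i <= j <= K ->
  walk (u i) (u j) (map u (index_iota i j.+1)) (map w (index_iota i j)).
Proof. by case/andP=> ij jK; apply: walk_seg => // l Hl; apply: links; lia. Qed.

Let linkl l : l < K -> w l \in N (u l). Proof. by move/links/andP=> []. Qed.
Let linkr l : l < K -> w l \in N (u l.+1). Proof. by move/links/andP=> []. Qed.

(** The path is [u p, ..., u 0, u p.+1, ..., u K]; the jump uses [w p], which the rotation has just
    freed. *)
Lemma walk_rot_first p : p < K -> w p \in N (u 0) ->
  walk (u p) (u K) (map u (index_iota 0 K.+1)) (map w (index_iota 0 K)).
Proof.
move=> pK wp.
have W0 : walk (u p) (u 0) _ _ := walk_rev (@seg 0 p ltac:(lia)).
have W1 := @seg p.+1 K ltac:(lia).
apply: walk_perm (walk_cat W0 W1 wp (linkr pK)) _ _.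
  by rewrite -map_cat -index_iota_cat //; lia.
rewrite (@index_iota_cat 0 p K) ?(@index_iota_ltn p K) //; last by lia.
perm_count.
Qed.

Lemma walk_rot_last p : p < K -> w p \in N (u K) ->
  walk (u 0) (u p.+1) (map u (index_iota 0 K.+1)) (map w (index_iota 0 K)).
Proof.
move=> pK wp.
have W0 := @seg 0 p ltac:(lia).
have W1 : walk (u K) (u p.+1) _ _ := walk_rev (@seg p.+1 K ltac:(lia)).
apply: walk_perm (walk_cat W0 W1 (linkl pK) wp) _ _.
  by rewrite -map_cat -index_iota_cat //; lia.
rewrite (@index_iota_cat 0 p K) ?(@index_iota_ltn p K) //; last by lia.
perm_count.
Qed.

(** The path is [u p, ..., u 0, u p.+1, ..., u q.-1, u K, ..., u q], with [w p] and [w q.-1] for the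
    two jumps. *)
Lemma walk_rot_both p q : 0 < p -> p < q -> q < K ->
    w p \in N (u 0) -> w q.-1 \in N (u K) ->
  walk (u p) (u q) (map u (index_iota 0 K.+1)) (map w (index_iota 0 K)).
Proof.
move=> p0 pq qK wp wq.
have W0 : walk (u p) (u 0) _ _ := walk_rev (@seg 0 p ltac:(lia)).
have W2 : walk (u K) (u q) _ _ := walk_rev (@seg q K ltac:(lia)).
(* For [q = p.+1] the two jumps are the same edge: the middle stretch is empty and [w p] joins [u 0]
   to [u K] directly. *)
have [eq|pq1] := eqVneq q p.+1.
  rewrite eq /= in wq W2 *.
  apply: walk_perm (walk_cat W0 W2 wp wq) _ _.
    by rewrite -map_cat -index_iota_cat //; lia.
  rewrite (@index_iota_cat 0 p K) ?(@index_iota_ltn p K) //; [|lia..].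
  perm_count.
have r : p.+1 <= q.-1 <= K by move/eqP: pq1; lia.
have W1 := seg r.
have W := walk_cat W0 (walk_cat W1 W2 (@linkl q.-1 ltac:(lia)) wq) wp (@linkr p ltac:(lia)).
apply: walk_perm W _ _.
  rewrite (_ : q.-1.+1 = q); last by lia.
  by rewrite -!map_cat -!index_iota_cat //; lia.
rewrite (@index_iota_cat 0 p K) ?(@index_iota_ltn p K); [|lia..].
rewrite (@index_iota_cat p.+1 q.-1 K) ?(@index_iota_ltn q.-1 K); [|lia..].
rewrite (_ : q.-1.+1 = q); last by lia.
perm_count.
Qed.

(** Leaving out [u p] frees [w p], while [w p.-1] jumps from [u p.-1] to [u K]. If [w p] is also at
    [u 0], it closes this path into a cycle missing [u p]. *)
Lemma walk_skip p : 0 < p -> p < K -> w p.-1 \in N (u K) ->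
  exists2 es, walk (u 0) (u p.+1) (map u (index_iota 0 p ++ index_iota p.+1 K.+1)) es
            & perm_eq (w p :: es) (map w (index_iota 0 K)).
Proof.
move=> p0 pK wp.
have W0 := @seg 0 p.-1 ltac:(lia).
have W1 : walk (u K) (u p.+1) _ _ := walk_rev (@seg p.+1 K ltac:(lia)).
have W := walk_cat W0 W1 (@linkl p.-1 ltac:(lia)) wp.
rewrite (_ : p.-1.+1 = p) in W; last by lia.
eexists; first by rewrite map_cat; exact: W.
rewrite (@index_iota_cat 0 p.-1 K) ?(@index_iota_ltn p.-1 K); [|lia..].
rewrite (_ : p.-1.+1 = p) ?(@index_iota_ltn p K); [|lia..].
perm_count.
Qed.

End Crossing.

End Walks.

(** * The counting inequality and degrees at the ends of a path *)

Section Core.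

Variables (V E : finType) (N : V -> {set E}) (X : {set V}) (Y : {set E}) (K delta : nat).
Hypothesis cardX : #|X| = K.+1.
Hypothesis K_ge3 : 3 <= K.
Hypothesis NY : forall v, N v \subset Y.
Hypothesis degX : forall v, v \in X -> delta <= #|N v|.
Hypothesis K_lt_delta : K < delta.
Hypothesis cardY : #|Y| + 10 <= 4 * delta.

Let deg F v := #|N v :&: F|.

(** Double counting: an edge outside [F] is at no more than one vertex of [R]. *)
Lemma sum_card_disjoint (F : {set E}) (R : {set V}) :
    (forall a b, a \in R -> b \in R -> a != b -> N a :&: N b \subset F) ->
  \sum_(a in R) #|N a :\: F| <= #|Y :\: F|.
Proof.
move=> dis.
have -> : \sum_(a in R) #|N a :\: F| = \sum_(e in Y :\: F) \sum_(a in R) (e \in N a).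
  rewrite exchange_big; apply: eq_bigr => a _ /=.
  rewrite -sum1_card big_mkcond /= [RHS]big_mkcond /=; apply: eq_bigr => e _.
  rewrite !inE; case: (e \in F) => //=.
  by case: (boolP (e \in N a)) => [/(subsetP (NY a)) ->|_] //; case: ifP.
rewrite -sum1_card; apply: leq_sum => e; rewrite inE => /andP[eF _].
case: (pickP [pred a in R | e \in N a]) => [a /andP[aR ea]|none]; last first.
  by rewrite big1 // => a aR; have := none a; rewrite /= aR /= => ->.
rewrite (bigD1 a) //= ea big1 // => b /andP[bR ba].
apply/eqP; rewrite eqb0; apply: contra eF => eb.
by apply: (subsetP (dis _ _ aR bR _)); rewrite ?inE ?ea // eq_sym.
Qed.

(** With four vertices in [R] the terms in [delta] cancel; every further vertex forces another
    [delta] incidences with [F]. *)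
Lemma count_disjoint (F : {set E}) (R : {set V}) :
    F \subset Y -> R \subset X ->
    (forall a b, a \in R -> b \in R -> a != b -> N a :&: N b \subset F) ->
  #|F| + #|R| * delta + 10 <= 4 * delta + \sum_(a in R) deg F a.
Proof.
move=> FY RX dis.
have sF := sum_card_disjoint dis.
have cD : #|Y :\: F| + #|F| = #|Y|.
  by rewrite -(cardsID F Y) (setIidPr FY) addnC.
have : #|R| * delta <= \sum_(a in R) #|N a :\: F| + \sum_(a in R) deg F a.
  rewrite -big_split /= -sum_nat_const; apply: leq_sum => a aR.
  by rewrite addnC cardsID degX // (subsetP RX).
lia.
Qed.

(** A [walk] may repeat vertices and edges; comparison with the two enumerations makes each of them
    occur exactly once. *)
Definition hpath (F : {set E}) a b := walk N a b (enum X) (enum F).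

(* A cycle through all of [X] except [z], with edge set [F]. *)
Definition miss (F : {set E}) z := exists a b e vs es,
  [/\ walk N a b vs es, e \in N a, e \in N b,
      perm_eq (z :: vs) (enum X) & perm_eq (e :: es) (enum F)].

Lemma hpath_rev F a b : hpath F a b -> hpath F b a.
Proof. exact: walk_rev. Qed.

Lemma hpath_list a b vs es : walk N a b vs es -> perm_eq vs (enum X) -> uniq es ->
  hpath [set e in es] a b.
Proof.
move=> W pv ue; apply: walk_perm W _ _; first by rewrite perm_sym.
by rewrite perm_sym perm_enum_set.
Qed.

Lemma hpath_card F a b : hpath F a b -> #|F| = K.
Proof. by move=> /walk_size; rewrite -!cardE cardX => -[]. Qed.

Lemma hpath_subY F a b : hpath F a b -> F \subset Y.
Proof.
move=> W; apply/subsetP => e eF.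
have [v] : exists v, e \in N v by apply: walk_edges W _; rewrite mem_enum.
exact: (subsetP (NY v)).
Qed.

Hypothesis no_ham : forall F a b e,
  hpath F a b -> e \in N a -> e \in N b -> e \in F.

Lemma hpath_sub F a b : hpath F a b -> N a :&: N b \subset F.
Proof. by move=> h; apply/subsetP => e; rewrite inE => /andP[]; apply: no_ham. Qed.

(* Write the path as [u 0, w 0, u 1, ..., u K].  If [w p] is at [u 0] and [w p.-1] is at
   [u K], then a cycle with edge set [F] misses [u p]; these [u p] and the two ends are
   pairwise joined by paths with edge set [F], so [count_disjoint] applies to them. *)
Lemma path_bound d F a b : d <= K ->
    (forall F' z, miss F' z -> deg F' z <= d) -> hpath F a b ->
  exists2 mu, deg F a + deg F b <= K.+1 + mu & (mu <= 1) || (mu * (K - d) + 7 <= 2 * K).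
Proof.
move=> dK Hd h.
have cF := hpath_card h.
have [e0 _] : exists e0, e0 \in F by apply/set0Pn; rewrite -card_gt0 cF; lia.
have [u [w [u0 uK L pu pw]]] := walk_index e0 h.
rewrite -cardE cF in uK L pu pw.
have iK n : iota 0 n = index_iota 0 n by rewrite /index_iota subn0.
rewrite !iK in pu pw.
have uw : uniq (map w (index_iota 0 K)) by rewrite -(perm_uniq pw) enum_uniq.
have uu : uniq (map u (index_iota 0 K.+1)) by rewrite -(perm_uniq pu) enum_uniq.
have winj i j (Hi : i < K) (Hj : j < K) := uniq_iota_inj uw Hi Hj.
have uinj i j (Hi : i < K.+1) (Hj : j < K.+1) := uniq_iota_inj uu Hi Hj.
have memF e : (e \in F) = (e \in map w (index_iota 0 K)) by rewrite -(perm_mem pw) mem_enum.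
have wF i : i < K -> w i \in F by move=> Hi; rewrite memF map_f // mem_index_iota.
have uX i : i < K.+1 -> u i \in X.
  by move=> Hi; rewrite -mem_enum (perm_mem pu) map_f // mem_index_iota.
have toh c c' : walk N c c' (map u (index_iota 0 K.+1)) (map w (index_iota 0 K)) -> hpath F c c'.
  by move=> W; apply: walk_perm W _ _.
(* Positions of the edges at [a] and, shifted by one, at [b]: both sets lie among [K.+1] positions,
   so the degree sum exceeds [K.+1] by at most the number of common positions. *)
pose A := [set p : 'I_K.+1 | (p < K) && (w p \in N a)].
pose B := [set p : 'I_K.+1 | (0 < p) && (w p.-1 \in N b)].
pose M := A :&: B.
have cA : deg F a = #|A|.
  have injA : {in A &, injective (fun p : 'I_K.+1 => w p)}.
    move=> p q; rewrite !inE => /andP[pK _] /andP[qK _] e; apply/val_inj; exact: winj e.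
  rewrite -(card_in_imset injA); apply: eq_card => e; rewrite !inE.
  apply/andP/imsetP => [[ea]|[p]].
    rewrite memF => /mapP[p]; rewrite mem_index_iota => /= pK eq.
    exists (inord p); last by rewrite inordK //; lia.
    by rewrite inE inordK ?pK -?eq //; lia.
  by rewrite inE => /andP[pK wp] ->; rewrite wp wF.
have cB : deg F b = #|B|.
  have injB : {in B &, injective (fun p : 'I_K.+1 => w p.-1)}.
    move=> p q; rewrite !inE => /andP[p0 _] /andP[q0 _] e; apply/val_inj.
    have := winj p.-1 q.-1; have := ltn_ord p; have := ltn_ord q => H1 H2 /(_ _ _ e) /=; lia.
  rewrite -(card_in_imset injB); apply: eq_card => e; rewrite !inE.
  apply/andP/imsetP => [[ea]|[p]].
    rewrite memF => /mapP[p]; rewrite mem_index_iota => /= pK eq.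
    exists (inord p.+1); last by rewrite inordK //; lia.
    by rewrite inE inordK -?eq //; lia.
  by rewrite inE => /andP[p0 wp] ->; rewrite wp wF //; have := ltn_ord p; lia.
exists #|M|.
  rewrite cA cB -cardsUI leq_add2r.
  by apply: leq_trans (max_card _) _; rewrite card_ord.
have MP p : p \in M -> [/\ 0 < p, p < K, w p \in N (u 0) & w p.-1 \in N (u K)].
  by rewrite !inE u0 uK => /andP[/andP[pK wa] /andP[p0 wb]].
have [//|mu2] := leqP #|M| 1.
pose um (p : 'I_K.+1) := u p.
have uminj : injective um by move=> p q e; apply/val_inj; apply: uinj e; apply: ltn_ord.
pose R := [set um p | p in M :|: [set ord0; ord_max]].
have endN (p : 'I_K.+1) : p \in M -> (p != ord0) && (p != ord_max).
  move=> /MP[p0 pK _ _]; rewrite -!val_eqE /=; lia.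
have cE : #|[set (ord0 : 'I_K.+1); ord_max]| = 2.
  by rewrite cards2 -val_eqE /=; case: (0 == K) / eqP; lia.
have dME : [disjoint M & [set ord0; ord_max]].
  apply/pred0P => p /=; apply/negbTE/negP => /andP[/endN /andP[/negbTE n0 /negbTE nK]].
  by rewrite !inE n0 nK.
have cR : #|R| = #|M| + 2.
  rewrite card_imset // cardsU cE.
  by move: dME; rewrite -setI_eq0 => /eqP ->; rewrite cards0 subn0.
have pairM (p q : 'I_K.+1) : p \in M :|: [set ord0; ord_max] -> q \in M :|: [set ord0; ord_max] ->
    p < q -> N (um p) :&: N (um q) \subset F.
  move=> pM qM pq; apply: hpath_sub; apply: toh.
  have qK : q <= K by have := ltn_ord q.
  case/setUP: pM => [/MP[p0 pK wp _]|pE].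
    case/setUP: qM => [/MP[_ qK' _ wq]|qE]; first exact: walk_rot_both.
    have -> : um q = u K.
      by case/set2P: qE pq => -> //=; rewrite /um.
    exact: walk_rot_first.
  have p00 : um p = u 0 by case/set2P: pE pq => -> //=; lia.
  rewrite p00; case/setUP: qM => [/MP[q0 qK' _ wq]|qE].
    have := @walk_rot_last _ _ _ u w K L q.-1; rewrite prednK //; apply=> //; lia.
  have -> : um q = u K by case/set2P: qE pq => -> //=; rewrite /um.
  by apply: walk_seg => // l Hl; apply: L.
have RX : R \subset X by apply/subsetP => _ /imsetP[p _ ->]; apply: uX; apply: ltn_ord.
have dis : forall c c', c \in R -> c' \in R -> c != c' -> N c :&: N c' \subset F.
  move=> _ _ /imsetP[p pM ->] /imsetP[q qM ->] ne.
  case: (ltngtP p q) => [pq|pq|e]; first exact: pairM.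
    by rewrite setIC; apply: pairM.
  by rewrite (val_inj e) eqxx in ne.
have := count_disjoint (hpath_subY h) RX dis.
have -> : \sum_(c in R) deg F c = \sum_(p in M) deg F (um p) + (deg F a + deg F b).
  rewrite big_imset /=; last by move=> p q _ _; apply: uminj.
  rewrite (eq_bigl [in [predU M & [set ord0; ord_max]]]); last by move=> p; rewrite !inE.
  rewrite bigU //=; congr (_ + _).
  rewrite big_setU1 ?inE -?val_eqE /= ?big_set1 /um /= ?u0 ?uK //; lia.
have : \sum_(p in M) deg F (um p) <= #|M| * d.
  rewrite -sum_nat_const; apply: leq_sum => p /MP[p0 pK wa wb].
  apply: Hd.
  have [es W pe] := walk_skip L p0 pK wb.
  exists (u 0), (u p.+1), (w p), (map u (index_iota 0 p ++ index_iota p.+1 K.+1)), es.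
  split=> //.
  - by have /andP[] := L _ pK.
  - rewrite perm_sym; apply: perm_trans pu _.
    rewrite (@index_iota_cat 0 p K.+1) ?(@index_iota_ltn p K.+1); [|lia..].
    by rewrite /um; perm_count.
  - by rewrite perm_sym; apply: perm_trans pw _; rewrite perm_sym.
rewrite cR cF cA cB.
have : #|A| + #|B| <= K.+1 + #|M|.
  rewrite -cardsUI leq_add2r.
  by apply: leq_trans (max_card _) _; rewrite card_ord.
move: mu2; set mu := #|M|; set S := \sum_(p in M) _; move=> mu2 H1 H2 H3.
(* As [mu >= 2], [delta] may be replaced by [K.+1] in [(mu - 2) * delta]; the constant left over is
   [10 - 2 - 1 = 7]. *)
have : mu * (K - d) + mu * d = mu * K by rewrite -mulnDr subnK.
have : (mu - 2) * K.+1 <= (mu - 2) * delta by rewrite leq_mul2l K_lt_delta orbT.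
have : (mu + 2) * delta = (mu - 2) * delta + 4 * delta by rewrite -mulnDl; congr (_ * _); lia.
have : (mu - 2) * K.+1 + 2 * K.+1 = mu * K + mu by rewrite -mulnDl subnK // mulnS addnC.
lia.
Qed.

(* The cycle [x 0, w 0, x 1, w 1, ...] missing [z], indexed periodically by [nat]. *)
Definition cyc (F : {set E}) z (x : nat -> V) (w : nat -> E) :=
  [/\ forall i, x (i + K) = x i, forall i, w (i + K) = w i,
      forall i, (w i \in N (x i)) && (w i \in N (x i.+1)),
      perm_eq (z :: map x (iota 0 K)) (enum X)
    & perm_eq (map w (iota 0 K)) (enum F)].

Lemma miss_cyc F z : miss F z -> exists x w, cyc F z x w.
Proof.
move=> [a [b [e [vs [es [W ea eb pv pe]]]]]].
have [u [w [u0 un L pu pw]]] := walk_index e W.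
have sK : (size es).+1 = K.
  by rewrite -(walk_size W); have := perm_size pv; rewrite /= -cardE cardX => -[].
have K0 : 0 < K by lia.
have small i : i < K -> i %% K = i by move=> iK; rewrite modn_small.
(* The closing edge [e] takes the last index of each period. *)
exists (fun i => u (i %% K)), (fun i => if i %% K == size es then e else w (i %% K)).
split.
- by move=> i; rewrite modnDr.
- by move=> i; rewrite modnDr.
- move=> i; rewrite modnS.
  have rK : i %% K < K by rewrite ltn_mod.
  case: ifP => [/eqP ri|ri].
    have -> : K %| i.+1 by rewrite /dvdn -addn1 -modnDml ri addn1 sK modnn.
    by rewrite ri un u0 ea eb.
  have -> : (K %| i.+1) = false.
    rewrite /dvdn -addn1 -modnDml addn1 modn_small ?gtn_eqF //.
    by move/eqP: ri; lia.
  by apply: L; move/eqP: ri; lia.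
- apply: perm_trans pv; rewrite perm_cons perm_sym; apply: perm_trans pu _.
  rewrite sK (_ : map u (iota 0 K) = map (fun i => u (i %% K)) (iota 0 K)) //.
  by apply/eq_in_map => i; rewrite mem_iota => /andP[_ iK]; rewrite small.
- apply: perm_trans pe.
  have -> : map (fun i => if i %% K == size es then e else w (i %% K)) (iota 0 K)
          = rcons (map w (iota 0 (size es))) e.
    rewrite -sK -addn1 iotaD map_cat /= add0n addn1 sK small ?eqxx ?cats1; last by lia.
    congr rcons; apply/eq_in_map => i; rewrite mem_iota => /andP[_ iK].
    by rewrite small ?ltn_eqF //; lia.
  by rewrite perm_rcons perm_cons perm_sym.
Qed.

(** * Rerouting a cycle that misses one vertex *)

Section Cycle.

Variables (F : {set E}) (z : V) (x : nat -> V) (w : nat -> E).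
Hypothesis C : cyc F z x w.

Lemma cyc_x i : x (i + K) = x i. Proof. by case: C. Qed.
Lemma cyc_w i : w (i + K) = w i. Proof. by case: C. Qed.
Lemma cyc_l i : w i \in N (x i). Proof. by case: C => _ _ /(_ i)/andP[]. Qed.
Lemma cyc_r i : w i \in N (x i.+1). Proof. by case: C => _ _ /(_ i)/andP[]. Qed.

Lemma cyc_shift s : cyc F z (fun i => x (s + i)) (fun i => w (s + i)).
Proof.
case: (C) => px pw L pv pe.
have e (T : eqType) (f : nat -> T) : (forall i, f (i + K) = f i) ->
    perm_eq (map (fun i => f (s + i)) (iota 0 K)) (map f (iota 0 K)).
  move=> per; apply: perm_trans (perm_map_periodic per s).
  by rewrite /index_iota addKn -[in iota s](addn0 s) iotaDl -map_comp.
split=> [i|i|i||]; rewrite ?addnA ?px ?pw ?addnS //.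
  by apply: perm_trans pv; rewrite perm_cons; apply: e.
by apply: perm_trans pe; apply: e.
Qed.

Lemma cyc_perm_x s : perm_eq (z :: map x (index_iota s (s + K))) (enum X).
Proof.
case: (C) => px _ _ pv _; apply: perm_trans pv.
by rewrite perm_cons; apply: perm_map_periodic.
Qed.

Lemma cyc_perm_w s : perm_eq (map w (index_iota s (s + K))) (enum F).
Proof.
case: (C) => _ pw _ _ pe; apply: perm_trans pe.
exact: perm_map_periodic.
Qed.

Lemma cyc_seg i j : i <= j ->
  walk N (x i) (x j) (map x (index_iota i j.+1)) (map w (index_iota i j)).
Proof. by move=> ij; apply: walk_seg => // l _; rewrite cyc_l cyc_r. Qed.

Lemma cyc_zX : z \in X.
Proof. by rewrite -mem_enum -(perm_mem (cyc_perm_x 0)) inE eqxx. Qed.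

Lemma cyc_card : #|F| = K.
Proof. by rewrite cardE -(perm_size (cyc_perm_w 0)) size_map size_iota; lia. Qed.

Lemma cyc_xX i : (x i \in X) && (x i != z).
Proof.
have := cyc_perm_x i => p.
have mi : x i \in map x (index_iota i (i + K)) by rewrite map_f // mem_index_iota; lia.
rewrite -mem_enum -(perm_mem p) inE mi orbT /=.
have := enum_uniq (mem X); rewrite -(perm_uniq p) /= => /andP[zn _].
by apply: contra zn => /eqP <-.
Qed.

Lemma cyc_wF i : w i \in F.
Proof.
rewrite -mem_enum -(perm_mem (cyc_perm_w i)).
by rewrite map_f // mem_index_iota; lia.
Qed.

Lemma cyc_subY : F \subset Y.
Proof.
apply/subsetP => e; rewrite -mem_enum -(perm_mem (cyc_perm_w 0)).
by case/mapP => i _ ->; exact: (subsetP (NY (x i)) _ (cyc_l i)).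
Qed.

Lemma cyc_xP s v : v \in X -> v != z -> exists2 i, s <= i < s + K & v = x i.
Proof.
rewrite -mem_enum -(perm_mem (cyc_perm_x s)) inE => /orP[->//|/mapP[i]].
by rewrite mem_index_iota => H -> _; exists i.
Qed.

Lemma cyc_wP s e : e \in F -> exists2 i, s <= i < s + K & e = w i.
Proof.
rewrite -mem_enum -(perm_mem (cyc_perm_w s)) => /mapP[i].
by rewrite mem_index_iota => H ->; exists i.
Qed.

Lemma cyc_x_inj i j : i < j < i + K -> x i != x j.
Proof.
move=> ij; have := enum_uniq (mem X); rewrite -(perm_uniq (cyc_perm_x i)) /=.
rewrite (@index_iota_ltn i) /=; last by lia.
case/and3P=> _ /negP n _; apply/eqP => e; apply: n.
by rewrite e map_f // mem_index_iota; lia.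
Qed.

Lemma cyc_w_inj i j : i < j < i + K -> w i != w j.
Proof.
move=> ij; have := enum_uniq (mem F); rewrite -(perm_uniq (cyc_perm_w i)) /=.
rewrite (@index_iota_ltn i) /=; last by lia.
case/andP=> /negP n _; apply/eqP => e; apply: n.
by rewrite e map_f // mem_index_iota; lia.
Qed.

Lemma cyc_uniq_w s : uniq (map w (index_iota s (s + K))).
Proof. by rewrite (perm_uniq (cyc_perm_w s)) enum_uniq. Qed.

(** Otherwise [z] could be inserted between [x p] and [x p.+1]: only [w p] is given up there, so
    neither [c] nor [c'] is used elsewhere on the cycle. *)
Lemma cyc_no_insert p c c' :
    c \in N (x p) -> c \in N z -> c' \in N z -> c' \in N (x p.+1) -> c != c' ->
    (c == w p) || (c \notin F) -> (c' == w p) || (c' \notin F) -> False.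
Proof.
move=> cp cz c'z c'p cc' cF c'F.
have pK : p < p + K by move: K_ge3; clear; lia.
have W := walk_cat (cyc_seg pK) (walk_nil N z) (_ : c \in _) cz.
rewrite cyc_x in W; have {}W := W cp; rewrite cats1 cats0 in W.
have u1 := cyc_uniq_w p; rewrite (index_iota_ltn pK) /= in u1.
case/andP: u1 => u1 u2.
have inF e : e \in map w (index_iota p.+1 (p + K)) -> e \in F by case/mapP=> i _ ->; exact: cyc_wF.
have out e : (e == w p) || (e \notin F) -> e \notin map w (index_iota p.+1 (p + K)).
  by case/orP=> [/eqP-> //|]; apply: contra; apply: inF.
have := no_ham (hpath_list W _ _) _ c'z; rewrite !inE => H.
have : (c' == c) || (c' \in map w (index_iota p.+1 (p + K))).
  apply: H => //=; last by rewrite out // u2.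
  rewrite perm_rcons; apply: perm_trans (cyc_perm_x p.+1).
  by rewrite addSn.
by rewrite eq_sym (negbTE cc') (negbTE (out _ c'F)).
Qed.

(* The path is [x p.+1, ..., x q, c', z, c, x p, x p.-1, ..., x q.+1]. *)
Lemma cyc_attach p q c c' :
    p < q < p + K -> c != c' ->
    c \in N (x p) -> c \in N z -> (c == w p) || (c \notin F) ->
    c' \in N (x q) -> c' \in N z -> (c' == w q) || (c' \notin F) ->
  hpath (c |: (c' |: F :\ w p :\ w q)) (x p.+1) (x q.+1).
Proof.
move=> pq cc' cp cz cF c'q c'z c'F.
have [pq1 qp] : p < q /\ q < p + K by case/andP: pq.
have W1 := cyc_seg pq1.
have W2 := walk_rev (cyc_seg qp).
rewrite cyc_x in W2.
have W := walk_cat (walk_cat W1 (walk_nil N z) c'q c'z) W2 cz cp.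
set L1 := map w (index_iota p.+1 q) in W; set L2 := map w (index_iota q.+1 _) in W.
have pw := cyc_perm_w p.
have windowE : index_iota p (p + K) = p :: index_iota p.+1 q ++ q :: index_iota q.+1 (p + K).
  by rewrite (@index_iota_cat p q) ?(index_iota_ltn pq1) ?(index_iota_ltn qp) // (ltnW pq1) (ltnW qp).
rewrite windowE /= map_cat /= -/L1 -/L2 in pw.
have memF e : (e \in F) = (e \in w p :: L1 ++ w q :: L2) by rewrite (perm_mem pw) mem_enum.
have uF : uniq (w p :: L1 ++ w q :: L2) by rewrite (perm_uniq pw) enum_uniq.
have uF' : uniq (w p :: w q :: L1 ++ L2).
  by rewrite -(perm_uniq (_ : perm_eq (w p :: L1 ++ w q :: L2) _)) //; perm_count.
have out e i : (e == w i) || (e \notin F) -> w i \notin L1 ++ L2 -> e \notin L1 ++ L2.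
  case/orP=> [/eqP->//|eF _]; apply: contra eF; rewrite memF inE !mem_cat inE.
  by case/orP => ->; rewrite ?orbT.
case/and3P: uF' => u1 u2 u3; rewrite inE negb_or in u1; case/andP: u1 => pq' u1.
have cL := out _ _ cF u1; have c'L := out _ _ c'F u2.
have -> : c |: (c' |: F :\ w p :\ w q) = [set e in c :: c' :: L1 ++ L2].
  apply/setP => e; rewrite !inE memF !inE !mem_cat !inE; congr (_ || (_ || _)).
  case: eqP => [->|nq] /=; first by rewrite -mem_cat (negbTE u2).
  by case: eqP => [->|np] //=; rewrite -mem_cat (negbTE u1).
apply: hpath_list; first apply: (walk_perm W) => //.
- by rewrite cats0.
- rewrite -catA /=; apply: perm_trans (cyc_perm_x p.+1).
  rewrite addSn (@index_iota_cat p.+1 q.+1 (p + K).+1); first by perm_count.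
  by move: pq; clear; lia.
- by rewrite /= inE negb_or cc' cL c'L.
Qed.

(** The path is [x q, ..., x p.+1, z, x q.+1, ..., x p]; it joins the vertices before [w p] and
    [w q], as [cyc_attach] joins those after them. *)
Lemma cyc_mirror p q : p < q < p + K -> w p \in N z -> w q \in N z ->
  hpath F (x q) (x p).
Proof.
move=> pq wp wq; have [pq1 qp] : p < q /\ q < p + K by case/andP: pq.
have W1 := walk_rev (cyc_seg pq1).
have W2 := cyc_seg qp; rewrite cyc_x in W2.
have W := walk_cat (walk_cat W1 (walk_nil N z) (cyc_r p) wp) W2 wq (cyc_r q).
apply: (walk_perm W); rewrite perm_sym.
  apply: perm_trans (cyc_perm_x p.+1).
  rewrite addSn (@index_iota_cat p.+1 q.+1 (p + K).+1); first by perm_count.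
  by move: pq; clear; lia.
apply: perm_trans (cyc_perm_w p).
have windowE : index_iota p (p + K) = p :: index_iota p.+1 q ++ q :: index_iota q.+1 (p + K).
  by rewrite (@index_iota_cat p q) ?(index_iota_ltn pq1) ?(index_iota_ltn qp) // (ltnW pq1) (ltnW qp).
by rewrite windowE; perm_count.
Qed.

(** [z] takes the place of [x p.+1] between [w p] and [w p.+1]. *)
Lemma cyc_swap p : w p \in N z -> w p.+1 \in N z -> miss F (x p.+1).
Proof.
move=> wp wq; have pK : p.+1 < p + K by move: K_ge3; clear; lia.
have W := walk_cat (walk_nil N z) (cyc_seg pK) wq (cyc_r p.+1).
rewrite cyc_x in W.
exists z, (x p), (w p); eexists; eexists; split; first exact: W; rewrite ?cyc_l //.
  apply: perm_trans (cyc_perm_x p.+1).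
  rewrite addSn (@index_iota_ltn p.+1 (p + K).+1); first by perm_count.
  by move: pK; clear; lia.
apply: perm_trans (cyc_perm_w p).
rewrite (@index_iota_ltn p) ?(index_iota_ltn pK) //; exact: ltnW.
Qed.

Lemma cyc_miss : miss F z.
Proof.
have K1 : 1 <= K by move: K_ge3; clear; lia.
have W := cyc_seg K1.
exists (x 1), (x K), (w 0); eexists; eexists; split; first exact: W.
- exact: cyc_r.
- by have := cyc_l 0; rewrite -(cyc_x 0).
- exact: (cyc_perm_x 1).
- by rewrite -[_ :: _]/(map w (0 :: index_iota 1 K)) -index_iota_ltn //; exact: (cyc_perm_w 0).
Qed.

Lemma cyc_x_mod i : x i = x (i %% K).
Proof.
rewrite [in LHS](divn_eq i K); elim: (i %/ K) => [|n IH] //.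
by rewrite mulSn -addnA addnC cyc_x.
Qed.

(** The exchange turns [w p] into an edge outside the cycle, to which restrictions on outside edges
    apply; it also serves to raise the degree of [z] into the edge set. *)
Lemma cyc_replace p y : p < K -> y \notin F -> y \in N (x p) -> y \in N (x p.+1) ->
  cyc (y |: F :\ w p) z x (fun i => if i %% K == p then y else w i).
Proof.
move=> pK yF yp yp1.
have pm : p %% K = p by rewrite modn_small.
have xm i : i %% K = p -> x i = x p by move=> e; rewrite cyc_x_mod e.
have xm1 i : i %% K = p -> x i.+1 = x p.+1.
  by move=> e; rewrite cyc_x_mod -addn1 -modnDml e addn1 -cyc_x_mod.
split=> [i|i|i||]; rewrite ?cyc_x ?modnDr ?cyc_w //.
- by case: eqP => [e|_]; rewrite ?cyc_l ?cyc_r // xm // xm1 // yp yp1.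
- by have := cyc_perm_x 0; rewrite /index_iota add0n subn0.
have e0 : iota 0 K = index_iota 0 p ++ p :: index_iota p.+1 K.
  by rewrite -index_iota_ltn // -index_iota_cat ?(ltnW pK) // /index_iota subn0.
have := cyc_uniq_w 0; have := cyc_perm_w 0; rewrite add0n {1 2}/index_iota subn0 e0.
rewrite !map_cat /= pm eqxx => pw uw.
have keep s : {subset s <= iota 0 K} -> p \notin s ->
    map (fun i => if i %% K == p then y else w i) s = map w s.
  move=> sK ps; apply/eq_in_map => i si; have := sK i si; rewrite mem_iota => /andP[_ iK].
  by rewrite modn_small //; case: eqP => // e; rewrite -e si in ps.
rewrite !keep; first last.
- by rewrite mem_index_iota ltnn andbF.
- by move=> i; rewrite mem_index_iota mem_iota; move: pK; clear; lia.
- by rewrite mem_index_iota ltnn.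
- by move=> i; rewrite mem_index_iota mem_iota; move: pK; clear; lia.
set L1 := map w (index_iota 0 p) in pw uw *; set L2 := map w (index_iota p.+1 K) in pw uw *.
have pc (e : E) : perm_eq (L1 ++ e :: L2) (e :: L1 ++ L2) by perm_count.
have memF e : (e \in F) = (e \in w p :: L1 ++ L2) by rewrite -(perm_mem (pc _)) (perm_mem pw) mem_enum.
rewrite (perm_uniq (pc _)) /= in uw; case/andP: uw => u1 u2.
apply: (perm_trans (pc y)); apply: uniq_perm; rewrite ?enum_uniq //=.
  by rewrite u2 andbT; apply: contra yF; rewrite memF inE => ->; rewrite orbT.
move=> e; rewrite mem_enum !inE memF inE; congr (_ || _).
by case: eqP => [->|] //=; apply/negbTE.
Qed.

End Cycle.

Lemma ord_window (i j : 'I_K) : i < j -> i < j < i + K.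
Proof. by move=> ij; rewrite ij (leq_trans (ltn_ord j)) // leq_addl. Qed.

(** * The degree of the missed vertex into the edge set of the cycle *)

Section CycleDegree.

Variables (F : {set E}) (z : V) (x : nat -> V) (w : nat -> E).
Hypothesis C : cyc F z x w.

Lemma cyc_w_mod i : w i = w (i %% K).
Proof.
rewrite [in LHS](divn_eq i K); elim: (i %/ K) => [|n IH] //.
by rewrite mulSn -addnA addnC (cyc_w C).
Qed.

Lemma cyc_x_ord_inj (i j : 'I_K) : x i.+1 = x j.+1 -> i = j.
Proof.
move=> e; apply/val_inj; case: (ltngtP i j) => // /ord_window ij.
  by have := @cyc_x_inj _ _ _ _ C i.+1 j.+1; rewrite ltnS addSn ltnS ij e eqxx => /(_ isT).
by have := @cyc_x_inj _ _ _ _ C j.+1 i.+1; rewrite ltnS addSn ltnS ij e eqxx => /(_ isT).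
Qed.

Lemma cyc_w_ord_inj (i j : 'I_K) : w i = w j -> i = j.
Proof.
move=> e; apply/val_inj; case: (ltngtP i j) => // /ord_window ij.
  by have := cyc_w_inj C ij; rewrite e eqxx.
by have := cyc_w_inj C ij; rewrite e eqxx.
Qed.

Lemma cyc_deg v : deg F v = #|[set i : 'I_K | w i \in N v]|.
Proof.
have inj : injective (fun i : 'I_K => w i) by move=> i j; apply: cyc_w_ord_inj.
rewrite -(card_imset _ inj); apply: eq_card => e; rewrite !inE.
apply/andP/imsetP => [[ev eF]|[i]]; last first.
  by rewrite inE => iv ->; rewrite iv (cyc_wF C).
have [i /andP[_ iK] ei] := cyc_wP C 0 eF.
by exists (Ordinal (iK : i < K)); rewrite ?inE -?ei.
Qed.

Lemma cyc_deg_le v : deg F v <= K.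
Proof. by rewrite -(cyc_card C) subset_leq_card // subsetIr. Qed.

Lemma cyc_attachF p q : p < q < p + K -> w p \in N z -> w q \in N z ->
  hpath F (x p.+1) (x q.+1).
Proof.
move=> pq wp wq.
have := cyc_attach C pq (cyc_w_inj C pq) (cyc_l C p) wp _ (cyc_l C q) wq.
rewrite !eqxx => /(_ isT isT); congr hpath; apply/setP => e; rewrite !inE.
case: eqP => [->|_]; first by rewrite (cyc_wF C).
by case: eqP => [->|_] //; rewrite (cyc_wF C).
Qed.

Lemma cyc_attach_ord (i j : 'I_K) : i != j -> w i \in N z -> w j \in N z ->
  hpath F (x i.+1) (x j.+1).
Proof.
move=> ij wi wj; case: (ltngtP i j) => [lt|lt|e].
- by apply: cyc_attachF => //; apply: ord_window.
- by apply: hpath_rev; apply: cyc_attachF => //; apply: ord_window.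
- by rewrite (val_inj e) eqxx in ij.
Qed.

Lemma cyc_sub_next p : w p \in N z -> N z :&: N (x p.+1) \subset F.
Proof.
move=> wp; apply/subsetP => e; rewrite inE => /andP[ez ep].
apply: contraT => eF; exfalso.
apply: (cyc_no_insert C (cyc_l C p) wp ez ep _ _ _); rewrite ?eqxx ?eF ?orbT //.
by apply: contraNneq eF => <-; exact: (cyc_wF C).
Qed.

Lemma cyc_sub_prev p : w p \in N z -> N z :&: N (x p) \subset F.
Proof.
move=> wp; apply/subsetP => e; rewrite inE => /andP[ez ep].
apply: contraT => eF; exfalso.
apply: (cyc_no_insert C ep ez wp (cyc_r C p) _ _ _); rewrite ?eqxx ?eF ?orbT //.
by apply: contraNneq eF => ->; exact: (cyc_wF C).
Qed.

(** The family consists of [z] and the vertices following the edges at [z]. Two of these vertices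
    are ends of a path with edge set [F]; if one of them shared an outside edge with [z], then [z]
    could be inserted before it. *)
Lemma cyc_count :
  K + (deg F z).+1 * delta + 10 <=
    4 * delta + deg F z + \sum_(i in [set i : 'I_K | w i \in N z]) deg F (x i.+1).
Proof.
set I := [set i | _]; pose R := z |: [set x (i : 'I_K).+1 | i in I].
have inj : injective (fun i : 'I_K => x i.+1) by move=> i j; apply: cyc_x_ord_inj.
have zR : z \notin [set x (i : 'I_K).+1 | i in I].
  apply/imsetP => -[i _ e]; have := cyc_xX C i.+1.
  by rewrite -e eqxx andbF.
have RX : R \subset X.
  apply/subsetP => v /setU1P[->|/imsetP[i _ ->]]; first exact: (cyc_zX C).
  by have /andP[] := cyc_xX C i.+1.
have dis a b : a \in R -> b \in R -> a != b -> N a :&: N b \subset F.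
  move=> /setU1P[->|/imsetP[i iI ->]] /setU1P[->|/imsetP[j jI ->]] ne.
  - by rewrite eqxx in ne.
  - by rewrite inE in jI; exact: cyc_sub_next.
  - by rewrite inE in iI; rewrite setIC; exact: cyc_sub_next.
  - rewrite !inE in iI jI; apply: hpath_sub; apply: cyc_attach_ord => //.
    by apply: contraNneq ne => ->.
have := count_disjoint (cyc_subY C) RX dis.
rewrite cardsU1 zR card_imset // -cyc_deg (cyc_card C) big_setU1 //=.
by rewrite big_imset /= ?addnA ?add1n // => i j _ _; apply: inj.
Qed.

End CycleDegree.

(** * A missed vertex on all edges of the cycle but at most one *)

(** By insertion, [z] shares no outside edge with any vertex of the cycle. Two other vertices both
    precede or both follow edges known to be at [z], and so are ends of a path with edge set [F],
    unless they are the two vertices around [w K.-1]. *)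
Lemma cyc_share F z x w v v' e : cyc F z x w -> (forall i, i < K.-1 -> w i \in N z) ->
    v \in X -> v' \in X -> v != v' -> e \notin F -> e \in N v -> e \in N v' ->
  (v = x K.-1 /\ v' = x 0) \/ (v = x 0 /\ v' = x K.-1).
Proof.
move=> C I vX v'X ne eF ev ev'.
have nz u : u \in X -> u != z -> e \in N u -> e \notin N z.
  move=> uX uz eu; have [i /andP[_ iK] ui] := cyc_xP C 0 uX uz; rewrite add0n in iK.
  apply: contra eF => ez; rewrite ui in eu.
  have [iK1|iK1] := ltnP i K.-1.
    by apply: (subsetP (cyc_sub_prev C (I _ iK1))); rewrite inE ez.
  have e1 : i = K.-2.+1 by move: iK1 iK K_ge3; clear; lia.
  rewrite e1 in eu; apply: (subsetP (cyc_sub_next C (I K.-2 _))); rewrite ?inE ?ez //.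
  by move: K_ge3; clear; lia.
have vz : v != z.
  apply: contraNneq eF => vz; have := nz _ v'X _ ev'.
  by rewrite -vz ev eq_sym ne => /(_ isT).
have v'z : v' != z.
  apply: contraNneq eF => v'z; have := nz _ vX _ ev.
  by rewrite -v'z ev' ne => /(_ isT).
have [i /andP[_ iK] vi] := cyc_xP C 0 vX vz.
have [j /andP[_ jK] vj] := cyc_xP C 0 v'X v'z.
rewrite !add0n in iK jK.
have main p q : p < q -> q < K -> e \in N (x p) -> e \in N (x q) -> q = K.-1 /\ p = 0.
  move=> pq qK ep eq.
  have pqK : p < q < p + K by move: pq qK; clear; lia.
  have [qK1|qK1] := ltnP q K.-1.
    have h := cyc_mirror C pqK (I p (ltn_trans pq qK1)) (I q qK1).
    by move: eF; rewrite (no_ham h).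
  split; first by move: qK qK1; clear; lia.
  case: p pq pqK ep => // p pq pqK ep; case: q pq qK eq qK1 pqK => // q pq qK eq qK1 pqK.
  have h : hpath F (x p.+1) (x q.+1).
    by apply: (cyc_attachF C); [| apply: I | apply: I]; move: pqK qK; clear; lia.
  by move: eF; rewrite (no_ham h).
rewrite vi vj in ne ev ev' *; case: (ltngtP i j) => [ij|ij|ij].
- by have [-> ->] := main _ _ ij jK ev ev'; right.
- by have [-> ->] := main _ _ ij iK ev' ev; left.
- by rewrite ij eqxx in ne.
Qed.

(** The super-neighborhood of [A], read off [N] instead of the incidence graph. *)
Definition shared (A : {set V}) := [set e | 1 < #|[set v in A | e \in N v]|].

Lemma sharedP (A : {set V}) e :
  reflect (exists v v', [/\ v \in A, v' \in A, v != v', e \in N v & e \in N v'])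
          (e \in shared A).
Proof.
rewrite inE; apply: (iffP card_gt1P) => [[v [v' []]]|[v [v' [vA v'A ne ev ev']]]].
  by rewrite !inE => /andP[vA ev] /andP[v'A ev'] ne; exists v, v'.
by exists v, v'; rewrite !inE vA v'A ev ev'.
Qed.

Hypothesis shared_ge : forall A : {set V}, A \subset X -> 3 <= #|A| -> #|A| <= #|shared A|.

Lemma shared_outside (F : {set E}) : #|F| = K -> exists2 e, e \notin F & e \in shared X.
Proof.
move=> cF; case: (boolP (shared X \subset F)) => [/subset_leq_card|/subsetPn[e eS eF]].
  have := shared_ge (subxx X); rewrite cF cardX => /(_ (leqW K_ge3)) H H'.
  by have := leq_trans H H'; rewrite ltnn.
by exists e.
Qed.

(** By (i) there is a shared edge [e] outside [F], and it can only join [x K.-1] and [x 0]. After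
    exchanging [w K.-1] for [e], the same holds for [w K.-1]. Hence the [K] vertices other than
    [x K.-1] share only edges of [F] different from [w K.-1], one too few for (i). *)
Lemma cyc_not_all_but_last F z x w : cyc F z x w -> (forall i, i < K.-1 -> w i \in N z) ->
  w K.-1 \notin N z -> False.
Proof.
move=> C I nI.
have [e eF /sharedP[v [v' [vX v'X ne ev ev']]]] := shared_outside (cyc_card C).
have K1 : K.-1 < K by move: K_ge3; clear; lia.
have xK : x K.-1.+1 = x 0 by rewrite prednK -?(cyc_x C 0) //; move: K_ge3; clear; lia.
have [eK e0] : e \in N (x K.-1) /\ e \in N (x K.-1.+1).
  by rewrite xK; have [[<- <-]|[<- <-]] := cyc_share C I vX v'X ne eF ev ev'.
have C' := cyc_replace C K1 eF eK e0.
have wF : w K.-1 \notin e |: F :\ w K.-1.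
  by rewrite !inE eqxx orbF; apply: contraNneq eF => <-; exact: (cyc_wF C).
have I' i : i < K.-1 -> (if i %% K == K.-1 then e else w i) \in N z.
  by move=> iK; rewrite modn_small ?ltn_eqF ?I //; exact: ltn_trans iK K1.
have cA : #|X :\ x K.-1| = K.
  by have := cardsD1 (x K.-1) X; rewrite cardX; have /andP[-> _] := cyc_xX C K.-1 => -[].
have := shared_ge (subD1set X (x K.-1)); rewrite cA => /(_ K_ge3).
have : shared (X :\ x K.-1) \subset F :\ w K.-1.
  apply/subsetP => f /sharedP[u [u' [/setD1P[ux uX] /setD1P[u'x u'X] une fu fu']]].
  rewrite !inE; apply/andP; split; apply: contraT.
    rewrite negbK => /eqP fw; rewrite fw in fu fu'.
    by have [[e1 _]|[_ e1]] := cyc_share C' I' uX u'X une wF fu fu';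
      rewrite e1 eqxx in ux u'x.
  move=> fF.
  by have [[e1 _]|[_ e1]] := cyc_share C I uX u'X une fF fu fu'; rewrite e1 eqxx in ux u'x.
move=> /subset_leq_card; have := cardsD1 (w K.-1) F; rewrite (cyc_wF C) (cyc_card C).
by move: K_ge3; clear; lia.
Qed.

(** A single edge of [F] not at [z] can be rotated to the last place. If there is none, any edge may
    play that role, and a shared outside edge would have to join both [x K.-1, x 0] and
    [x 0, x 1]. *)
Lemma cyc_not_near_full F z x w : cyc F z x w -> K <= (deg F z).+1 -> False.
Proof.
move=> C; rewrite (cyc_deg C); set I := [set i | _] => cI.
have K0 : 0 < K by move: K_ge3; clear; lia.
have [m mI] : exists m : 'I_K, forall i : 'I_K, i != m -> i \in I.
  case: (pickP [pred m | m \notin I]) => [m /= mI|all].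
    exists m => i im; apply: contraT => iI.
    have : [set i; m] \subset ~: I by apply/subsetP => j /set2P[]->; rewrite inE.
    move/subset_leq_card; rewrite cards2 im => c2; have := cardsC I; rewrite card_ord.
    by move: c2 cI; clear; lia.
  by exists (Ordinal K0) => i _; have := all i; rewrite /= => /negbFE.
have wI i : i %% K != m -> w i \in N z.
  move=> im; rewrite (cyc_w_mod C).
  by have := mI (Ordinal (ltn_pmod i K0)); rewrite -val_eqE /= inE => /(_ im).
have C' := cyc_shift C m.+1.
have shift i : i < K.-1 -> w (m.+1 + i) \in N z.
  move=> iK; apply: wI; have := ltn_ord m => mK.
  have [s|s] := ltnP (m.+1 + i) K; first by rewrite modn_small //; move: s; clear; lia.
  have -> : m.+1 + i = (m.+1 + i - K) + K by rewrite subnK.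
  by rewrite modnDr modn_small; move: iK mK s; clear; lia.
have [nm|nm] := boolP (w m \in N z); last first.
  apply: (cyc_not_all_but_last C' shift).
  have -> : m.+1 + K.-1 = m + K by move: K0; clear; lia.
  by rewrite (cyc_w C).
have [e eF /sharedP[v [v' [vX v'X ne ev ev']]]] := shared_outside (cyc_card C).
have all i : w i \in N z.
  by have [im|/wI //] := eqVneq (i %% K) m; rewrite (cyc_w_mod C) im.
have K3 := K_ge3.
have d1 : x 0 != x K.-1 by apply: (cyc_x_inj C); move: K3; clear; lia.
have d2 : x 1 != x K.-1 by apply: (cyc_x_inj C); move: K3; clear; lia.
have xK : x (1 + K.-1) = x 0 by rewrite add1n prednK ?(cyc_x C 0).
have := cyc_share C (fun i _ => all i) vX v'X ne eF ev ev'.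
have := cyc_share (cyc_shift C 1) (fun i _ => all _) vX v'X ne eF ev ev'.
rewrite xK addn0; move/eqP: d1 => d1; move/eqP: d2 => d2.
by case=> [[-> ->]|[-> ->]] [[e1 e2]|[e1 e2]]; congruence.
Qed.

(* The vertices following the [d] edges of [F] at [z] form with [z] a family for
   [count_disjoint]; [path_bound] bounds their degrees into [F] pairwise, which is
   contradictory unless [K - d <= 2].  If [K - d = 2], all but two of them can be
   exchanged with [z] and so have degree at most [d] into [F]. *)
Lemma not_miss_dense d F z : 4 <= d -> d <= K ->
    (forall F' z', miss F' z' -> deg F' z' <= d) -> miss F z -> deg F z = d -> False.
Proof.
move=> d4 dK Hd /miss_cyc[x [w C]] Fd.
have K0 : 0 < K by move: K_ge3; clear; lia.
have u2 : d.+2 <= K.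
  by have := cyc_not_near_full C; rewrite Fd; case: leqP => // _ /(_ isT).
have cnt := cyc_count C; rewrite Fd in cnt.
have cI := cyc_deg C z; rewrite Fd in cI.
set I := [set i | _] in cnt cI.
have hI (i j : 'I_K) : i \in I -> j \in I -> i != j -> hpath F (x i.+1) (x j.+1).
  by rewrite !inE => iI jI ij; apply: (cyc_attach_ord C).
have {cnt} : K + (d - 3) * K.+1 + 10 <= d + \sum_(i in I) deg F (x i.+1).
  have : (d - 3) * K.+1 <= (d - 3) * delta by rewrite leq_mul2l K_lt_delta orbT.
  have : d.+1 * delta = (d - 3) * delta + 4 * delta.
    by rewrite -mulnDl; congr (_ * _); move: d4; clear; lia.
  by move: cnt; clear; lia.
have [eK|nK] := eqVneq K d.+2.
  pose NS := [set i in I | ordS i \notin I].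
  have NSI : NS \subset I by apply/subsetP => i; rewrite inE => /andP[].
  have cNS : #|NS| <= 2.
    rewrite -(card_imset _ (@ordS_inj K)).
    have sub : [set ordS i | i in NS] \subset ~: I.
      by apply/subsetP => _ /imsetP[i iNS ->]; move: iNS; rewrite !inE => /andP[].
    apply: leq_trans (subset_leq_card sub) _; have := cardsC I; rewrite card_ord.
    by move: eK cI; clear; lia.
  rewrite (big_setID NS) /= (setIidPr NSI).
  have : \sum_(i in I :\: NS) deg F (x i.+1) <= (d - #|NS|) * d.
    have -> : d - #|NS| = #|I :\: NS| by rewrite cardsD (setIidPr NSI) -cI.
    rewrite -sum_nat_const; apply: leq_sum => i /setDP[iI]; rewrite inE iI negbK inE => Si.
    apply: Hd; apply: (cyc_swap C); first by rewrite inE in iI.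
    by rewrite (cyc_w_mod C).
  case: (ltnP #|NS| 2) => [NS1|NS2].
    have : \sum_(i in NS) deg F (x i.+1) <= #|NS| * K.
      rewrite -sum_nat_const; apply: leq_sum => i _.
      exact: (cyc_deg_le C).
    move: (\sum_(i in NS) _) (\sum_(i in I :\: NS) _) eK d4 NS1; clear.
    case: #|NS| => [|[|//]] s1 s2 eK d4 _; subst K; nia.
  (* Bounding both exceptional degrees by [K] would not suffice; [path_bound] with [K - d = 2]
     bounds their sum by [K.+1 + (d - 2)]. *)
  have /cards2P[i [j [ij e]]] : #|NS| == 2 by rewrite eqn_leq cNS.
  have iI : i \in I by apply: (subsetP NSI); rewrite e !inE eqxx.
  have jI : j \in I by apply: (subsetP NSI); rewrite e !inE eqxx orbT.
  rewrite e cards2 ij big_setU1 ?inE //= big_set1.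
  have [mu] := path_bound dK Hd (hI _ _ iI jI ij).
  move: (\sum_(i in I :\: _) _) (#|N (x i.+1) :&: F|) (#|N (x j.+1) :&: F|) eK d4; clear.
  move=> s a b eK d4; subst K.
  have -> : d.+2 - d = 2 by lia.
  nia.
set u := K - d; have Ku : K = d + u by rewrite /u; move: dK; clear; lia.
have u3 : 3 <= u by rewrite /u; move/eqP: nK; move: u2; clear; lia.
(* Degrees are scaled by [u] because [path_bound] controls the product [mu * u]; the bound
   [2 * K - 7] also covers [mu <= 1]. *)
have := @sum_pair_bound _ I (fun i => u * deg F (x i.+1)) (u * K.+1 + (2 * K - 7)).
rewrite -cI -big_distrr => /(_ (leq_trans (isT : 2 <= 4) d4)) /=.
have pb (i j : 'I_K) : i \in I -> j \in I -> i != j ->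
    u * deg F (x i.+1) + u * deg F (x j.+1) <= u * K.+1 + (2 * K - 7).
  move=> iI jI ij; have [mu] := path_bound dK Hd (hI _ _ iI jI ij).
  rewrite -/u -mulnDr => le H.
  apply: leq_trans (leq_mul (leqnn u) le) _; rewrite mulnDr leq_add2l mulnC.
  case/orP: H => H; last by move: H; clear; lia.
  apply: leq_trans (leq_mul H (leqnn u)) _; rewrite Ku; move: d4 u3; clear; lia.
move=> /(_ pb).
move: (\sum_(i in I) _) => S le cnt; clearbody u; move: le cnt Ku d4 u3; clear.
move=> le cnt Ku; subst K; move: le cnt.
case: d => [|[|[|[|a]]]] //; case: u => [|[|[|b]]] //.
have -> : a.+4 - 3 = a.+1 by lia.
have -> : 2 * (a.+4 + b.+3) - 7 = 2 * a + 2 * b + 7 by lia.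
nia.
Qed.

(** A bound valid for all missed vertices starts at [K] and is lowered by one at a time,
    [not_miss_dense] excluding equality as long as it is above 3. *)
Lemma miss_deg_le3 F z : miss F z -> deg F z <= 3.
Proof.
suff H n : forall F z, miss F z -> deg F z <= 3 + (K - 3 - n).
  by move=> m; have := H (K - 3) F z m; rewrite subnn.
elim: n => [|n IH] {}F {}z m.
  have [x [w C]] := miss_cyc m.
  by rewrite subn0 subnKC // -(cyc_card C) subset_leq_card // subsetIr.
have {}IH' := IH F z m.
have [//|lt] := leqP (deg F z) (3 + (K - 3 - n.+1)).
exfalso; apply: (@not_miss_dense (3 + (K - 3 - n)) F z) => //; move: lt IH' K_ge3; clear; lia.
Qed.

(** * Attaching the missed vertex by edges outside the cycle *)

Section Attachments.

Variables (F : {set E}) (z : V) (x : nat -> V) (w : nat -> E).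
Hypothesis C : cyc F z x w.

Let I := [set i : 'I_K | w i \in N z].
Let outer p := N (x p) :&: (N z :\: F).
Hypothesis outer_alternates : forall p, (outer p == set0) || (outer p.+1 == set0).

Lemma outer_at p : w p \in N z -> outer p = set0.
Proof.
move=> wp; apply/setP => e; rewrite !inE; apply/negP => /and3P[ep eF ez].
by move: eF; rewrite (subsetP (cyc_sub_prev C wp)) // inE ez.
Qed.

Lemma outer_next p : w p \in N z -> outer p.+1 = set0.
Proof.
move=> wp; apply/setP => e; rewrite !inE; apply/negP => /and3P[ep eF ez].
by move: eF; rewrite (subsetP (cyc_sub_next C wp)) // inE ez.
Qed.

(* The edges through which [z] can be joined to [x p] without using [w q] for [q <> p]. *)
Let conn (p : 'I_K) := if p \in I then [set w p] else outer p.

Lemma connP (p : 'I_K) c : c \in conn p ->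
  [/\ c \in N (x p), c \in N z & if p \in I then c = w p else c \notin F].
Proof.
rewrite /conn; case: (boolP (p \in I)) => [pI /set1P ->|_].
  by rewrite (cyc_l C); split=> //; rewrite inE in pI.
by rewrite !inE => /and3P[-> -> ->].
Qed.

(** The path gives up [w p] when [z] is attached to [x p] from outside [F], and keeps it when [w p]
    is the attaching edge itself. The inclusions record what is common to the edge sets of all pairs
    from [P]. *)
Lemma conn_hpath (P : {set 'I_K}) (p q : 'I_K) c c' :
    p \in P -> q \in P -> p != q -> c \in conn p -> c' \in conn q -> c != c' ->
  exists F', [/\ hpath F' (x p.+1) (x q.+1), F :\: [set w (i : 'I_K) | i in P :\: I] \subset F',
     F' \subset F :|: N z, p \notin I -> w p \notin F' & q \notin I -> w q \notin F'].
Proof.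
wlog pq : p q c c' / p < q => [H pP qP ne|].
  case: (ltngtP p q) => [lt|lt|e]; first exact: H.
    move=> cp cq cc'; have [||F' [h s1 s2 s3 s4]] := H q p c' c lt qP pP _ cq cp.
    - by rewrite eq_sym.
    - by rewrite eq_sym.
    by exists F'; split=> //; apply: hpath_rev.
  by rewrite (val_inj e) eqxx in ne.
move=> pP qP _ /connP[cp cz cI] /connP[cq c'z c'I] cc'.
have wpq : w p != w q by apply: (cyc_w_inj C); apply: ord_window.
have cF : (c == w p) || (c \notin F) by move: cI; case: ifP => _ => [->|->]; rewrite ?eqxx ?orbT.
have c'F : (c' == w q) || (c' \notin F) by move: c'I; case: ifP => _ => [->|->]; rewrite ?eqxx ?orbT.
have h := cyc_attach C (ord_window pq) cc' cp cz cF cq c'z c'F.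
have nin (f : E) : f \in F -> f != w p -> f != w q ->  f \in c |: (c' |: F :\ w p :\ w q).
  by move=> fF fp fq; rewrite !inE fF fp fq !orbT.
eexists; split; first exact: h.
- apply/subsetP => e /setDP[eF eI].
  have out i : i \in P -> e = w i -> i \in I.
    move=> iP ei; apply: contraT => iI; case/negP: eI; apply/imsetP; exists i => //.
    by rewrite !inE iP andbT; rewrite inE in iI.
  have [ep|ep] := eqVneq e (w p).
    by move: cI; rewrite (out _ pP ep) => cwp; rewrite !inE ep cwp eqxx.
  have [eq|eq] := eqVneq e (w q).
    by move: c'I; rewrite (out _ qP eq) => cwq; rewrite !inE eq cwq eqxx orbT.
  exact: nin.
- apply/subsetP => e; rewrite !inE => /or3P[/eqP->|/eqP->|/and3P[_ _ ->]] //.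
    by rewrite cz orbT.
  by rewrite c'z orbT.
- move=> pI; rewrite (negbTE pI) in cI; rewrite !inE eqxx andbF !orbF.
  rewrite negb_or; apply/andP; split; first by apply: contraNneq cI => <-; exact: (cyc_wF C).
  case/orP: c'F => [/eqP->//|]; apply: contraNneq => <-; exact: (cyc_wF C).
- move=> qI; rewrite (negbTE qI) in c'I; rewrite !inE eqxx /= orbF.
  rewrite negb_or; apply/andP; split; last by apply: contraNneq c'I => <-; exact: (cyc_wF C).
  case/orP: cF => [/eqP->|]; first by rewrite eq_sym.
  by apply: contraNneq => <-; exact: (cyc_wF C).
Qed.

(** The family is [z] with the vertices following the positions in [P]. With [e = #|P| - 3] the
    count gives [2 * (K + 7 + e * K) <= (e + 3) * (K + 2)], which leaves only [e = 0] and
    [8 <= K]. *)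
Lemma attachments_bound (P : {set 'I_K}) : I \subset P -> 3 <= #|P| ->
    (forall p, p \in P -> conn p != set0) ->
    (forall p q, p \in P -> q \in P -> p != q ->
       exists c c', [/\ c \in conn p, c' \in conn q & c != c']) ->
  #|P| = 3 /\ 8 <= K.
Proof.
move=> IP P3 Pn HP.
(* [w p] is freed when [z] is attached to [x p] from outside [F]. *)
pose Ft := F :\: [set w (i : 'I_K) | i in P :\: I].
have K3 := K_ge3.
have Pout p : p \in P -> outer p.+1 = set0.
  move=> pP; have := Pn p pP; rewrite /conn; case: ifP => [|_ np].
    by rewrite inE => wp _; apply: outer_next.
  by have := outer_alternates p; rewrite (negbTE np) => /eqP.
have Pz p e : p \in P -> e \in N (x p.+1) -> e \in N z -> e \in F.
  move=> pP ep ez; apply: contraT => eF.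
  by have := in_set0 e; rewrite -(Pout p pP) !inE ep ez eF.
have hP p q : p \in P -> q \in P -> p != q ->
    exists F', [/\ hpath F' (x p.+1) (x q.+1), Ft \subset F',
     F' \subset F :|: N z, p \notin I -> w p \notin F' & q \notin I -> w q \notin F'].
  by move=> pP qP pq; have [c [c' [cp c'q cc']]] := HP p q pP qP pq; exact: conn_hpath cc'.
have injx : injective (fun i : 'I_K => x i.+1) by move=> i j; apply: (cyc_x_ord_inj C).
have injw : injective (fun i : 'I_K => w i) by move=> i j; apply: (cyc_w_ord_inj C).
have disP p q : p \in P -> q \in P -> p != q -> N (x p.+1) :&: N (x q.+1) \subset Ft.
  move=> pP qP pq; have [F' [h sF sF' wp wq]] := hP _ _ pP qP pq.
  apply/subsetP => e /setIP[ep eq]; have eF' := no_ham h ep eq.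
  have eF : e \in F.
    by have /setUP[//|] := subsetP sF' _ eF'; apply: Pz pP ep.
  rewrite inE eF andbT; apply/imsetP => -[r /setDP[rP rI] er].
  (* The common edge would be [w r], which also lies at [x r.+1]; the path for the pair [p, r] gives
     up [w r], so [w r] would close it. *)
  have rp : p != r by apply: contraTneq eF' => pr; rewrite er -pr wp // pr.
  have [F2 [h2 _ _ _ wr]] := hP _ _ pP rP rp.
  have := no_ham h2 ep; rewrite er => /(_ (cyc_r C r)) wF2.
  by move: (wr rI); rewrite wF2.
pose f (p : 'I_K) := deg Ft (x p.+1).
have pb p q : p \in P -> q \in P -> p != q -> f p + f q <= K.+2.
  move=> pP qP pq; have [F' [h sF _ _ _]] := hP _ _ pP qP pq.
  have [mu le H] := path_bound K3 miss_deg_le3 h.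
  (* For [d = 3], [mu >= 2] is impossible since [2 * (K - 3) + 7 > 2 * K]. *)
  have mu1 : mu <= 1.
    by move: H K3; clear; case: mu => [|[|mu]] //= H K3; nia.
  have dle v : deg Ft v <= deg F' v by apply: subset_leq_card; apply: setIS.
  apply: leq_trans (leq_add (dle _) (dle _)) _.
  by move: le mu1; clear; lia.
have := sum_pair_bound (ltnW P3) pb.
pose R := z |: [set x (i : 'I_K).+1 | i in P].
have zR : z \notin [set x (i : 'I_K).+1 | i in P].
  apply/imsetP => -[i _ e]; have := cyc_xX C i.+1.
  by rewrite -e eqxx andbF.
have RX : R \subset X.
  apply/subsetP => v /setU1P[->|/imsetP[i _ ->]]; first exact: (cyc_zX C).
  by have /andP[] := cyc_xX C i.+1.
have disz p : p \in P -> N z :&: N (x p.+1) \subset Ft.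
  move=> pP; apply/subsetP => e /setIP[ez ep].
  rewrite inE (Pz p e pP ep ez) andbT; apply/imsetP => -[r /setDP[rP]].
  by rewrite inE => rI er; rewrite er (negbTE rI) in ez.
have dis a b : a \in R -> b \in R -> a != b -> N a :&: N b \subset Ft.
  move=> /setU1P[->|/imsetP[i iP ->]] /setU1P[->|/imsetP[j jP ->]] ne.
  - by rewrite eqxx in ne.
  - exact: disz.
  - by rewrite setIC; exact: disz.
  - by apply: disP => //; apply: contraNneq ne => ->.
have FtY : Ft \subset Y by apply: subset_trans (subsetDl _ _) (cyc_subY C).
have := count_disjoint FtY RX dis.
rewrite cardsU1 zR card_imset // big_setU1 //= big_imset /=; last by move=> i j _ _; apply: injx.
have : deg Ft z <= #|I|.
  by rewrite -(cyc_deg C); apply: subset_leq_card; apply/setIS/subsetDl.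
have : #|Ft| + #|P| = K + #|I|.
  rewrite cardsD (cyc_card C) (setIidPr _); last first.
    by apply/subsetP => _ /imsetP[i _ ->]; exact: (cyc_wF C).
  rewrite card_imset // cardsD (setIidPr IP).
  have PK : #|P| <= K by apply: leq_trans (max_card _) _; rewrite card_ord.
  have aux a b : b <= a -> a <= K -> K - (a - b) + a = K + b by clear; lia.
  exact: aux (subset_leq_card IP) PK.
rewrite -/f; set S := \sum_(i in P) _; set g := deg Ft z.
have : (#|P| - 3) * K.+1 <= (#|P| - 3) * delta by rewrite leq_mul2l K_lt_delta orbT.
have : (1 + #|P|) * delta = (#|P| - 3) * delta + 4 * delta.
  by rewrite -mulnDl; congr (_ * _); move: P3; clear; lia.
move: S g (#|Ft|) (#|I|) P3 K3; clear; case: #|P| => [|[|[|e]]] // S g t i _ K3.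
rewrite (_ : e.+3 - 3 = e); last by lia.
move=> H1 H2 H3 H4 H5 H6.
have {H1 H2 H3 H4 H5} H : 2 * (K + 7 + e * K) <= 2 * S by lia.
have e0 : e = 0 by nia.
by subst e; split=> //; lia.
Qed.

(* [H] consists of the edges of [F] at [z] and of the edges outside [F] that are the only
   ones joining [z] to some [x p]; [B] consists of the [x p] joined to [z] by two of them. *)
Lemma links_bound : exists (H : {set E}) (B : {set V}),
  [/\ #|H| + #|B| <= 3, #|H| + #|B| = 3 -> 8 <= K
    & forall v, v \in X -> v != z -> v \notin B -> N z :&: N v \subset H].
Proof.
pose D := [set p : 'I_K | 1 < #|outer p|].
pose L := [set e | [exists p : 'I_K, outer p == [set e]]].
have K0 : 0 < K by move: K_ge3; clear; lia.
(* One position is kept for each edge of [L]: two positions with the same single attaching edge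
   cannot be used together, as a path through [z] needs two different edges. *)
pose rep e : 'I_K := odflt (Ordinal K0) [pick p : 'I_K | outer p == [set e]].
have repP e : e \in L -> outer (rep e) = [set e].
  rewrite inE /rep => /existsP[p pe]; case: pickP => [q /eqP //|/(_ p)].
  by rewrite pe.
have repinj : {in L &, injective rep}.
  by move=> e e' eL e'L ee'; apply: set1_inj; rewrite -(repP e) // -(repP e') // ee'.
pose P := I :|: (D :|: rep @: L).
have outI (p : 'I_K) : p \in I -> outer p = set0 by rewrite inE; apply: outer_at.
have cP : #|P| = #|I| + (#|D| + #|L|).
  rewrite -(card_in_imset repinj) /P !cardsU.
  have -> : D :&: rep @: L = set0.
    apply/setP => p; rewrite !inE; apply/negP => /andP[D1 /imsetP[e eL pe]].
    by rewrite pe (repP _ eL) cards1 in D1.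
  have -> : I :&: (D :|: rep @: L) = set0.
    apply/setP => p; rewrite inE in_set0; apply/negP => /andP[pI /setUP[|/imsetP[e eL pe]]].
      by rewrite inE (outI _ pI) cards0.
    by move: (set11 e); rewrite -(repP _ eL) -pe (outI _ pI) inE.
  by rewrite !cards0 !subn0.
have Pn p : p \in P -> conn p != set0.
  rewrite /conn; case: ifP => [_ _|pI]; first by apply/set0Pn; exists (w p); rewrite set11.
  move=> /setUP[|/setUP[|/imsetP[e eL ->]]]; first by rewrite pI.
    by rewrite inE -card_gt0; apply: ltnW.
  by rewrite (repP _ eL); apply/set0Pn; exists e; rewrite set11.
have single p e : p \in P -> conn p = [set e] ->
    if p \in I then e = w p else (outer p = [set e]) /\ p = rep e.
  rewrite /conn; case: ifP => [_ _ /set1_inj //|pI pP oe]; split=> //.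
  case/setUP: pP => [|/setUP[|/imsetP[e' eL pe]]]; first by rewrite pI.
    by rewrite inE oe cards1.
  by move: oe; rewrite pe (repP _ eL) => /set1_inj ->.
have HP p q : p \in P -> q \in P -> p != q ->
    exists c c', [/\ c \in conn p, c' \in conn q & c != c'].
  move=> pP qP pq; have /set0Pn[c cp] := Pn p pP; have /set0Pn[c' c'q] := Pn q qP.
  have [cc'|cc'] := eqVneq c c'; last by exists c, c'.
  case: (boolP (conn p == [set c])) => [/eqP e1|n1]; last first.
    have /subsetPn[d dp dc] : ~~ (conn p \subset [set c]).
      by apply: contra n1 => s; rewrite eqEsubset s sub1set.
    by exists d, c'; split=> //; rewrite -cc'; rewrite inE in dc.
  case: (boolP (conn q == [set c])) => [/eqP e2|n2]; last first.
    have /subsetPn[d dq dc] : ~~ (conn q \subset [set c]).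
      by apply: contra n2 => s; rewrite eqEsubset s sub1set cc'.
    by exists c, d; split=> //; rewrite inE eq_sym in dc.
  have := single p c pP e1; have := single q c qP e2.
  have outF (r : 'I_K) : outer r = [set c] -> c \notin F.
    by move=> o; have := set11 c; rewrite -o !inE => /and3P[].
  case: ifP => _ => [cq|[oq qr]]; case: ifP => _ => [cp'|[op pr]].
  - by rewrite (cyc_w_ord_inj C (etrans (esym cp') cq)) eqxx in pq.
  - by move: (outF _ op); rewrite cq (cyc_wF C).
  - by move: (outF _ oq); rewrite cp' (cyc_wF C).
  - by rewrite pr qr eqxx in pq.
exists ([set w (i : 'I_K) | i in I] :|: L), [set x (i : 'I_K) | i in D].
have cHB : #|[set w (i : 'I_K) | i in I] :|: L| + #|[set x (i : 'I_K) | i in D]| <= #|P|.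
  rewrite cP addnCA addnC leq_add ?leq_imset_card //.
  by apply: leq_trans (leq_card_setU _ _) _; rewrite leq_add2r leq_imset_card.
have IP : I \subset P by apply: subsetUl.
split.
- have [P3|P3] := leqP 3 #|P|; last by apply: leq_trans cHB _; apply: ltnW.
  by have [<- _] := attachments_bound IP P3 Pn HP.
- by move=> e3; rewrite e3 in cHB; have [] := attachments_bound IP cHB Pn HP.
move=> v vX vz vB; have [i /andP[_ iK] vi] := cyc_xP C 0 vX vz.
apply/subsetP => e /setIP[ez ev]; apply/setUP.
case: (boolP (e \in F)) => eF.
  have [j /andP[_ jK] ej] := cyc_wP C 0 eF.
  left; apply/imsetP; exists (Ordinal (jK : j < K)) => //.
  by rewrite inE /= -ej.
right; rewrite inE; apply/existsP; exists (Ordinal (iK : i < K)) => /=.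
have eo : e \in outer i by rewrite !inE -vi ev ez eF.
rewrite eq_sym eqEcard sub1set eo cards1 leqNgt; apply: contra vB => oi.
by apply/imsetP; exists (Ordinal (iK : i < K)); rewrite ?inE.
Qed.

End Attachments.

(* If [e] outside [F] joins [z] to both [x p] and [x p.+1], replacing [w p] by [e]
   increases the degree of [z] into the edge set of the cycle. *)
Lemma miss_links F z : miss F z -> exists (H : {set E}) (B : {set V}),
  [/\ #|H| + #|B| <= 3, #|H| + #|B| = 3 -> 8 <= K
    & forall v, v \in X -> v != z -> v \notin B -> N z :&: N v \subset H].
Proof.
have [n] := ubnP (K - deg F z); elim: n F => // n IH F leK m.
have [x [w C]] := miss_cyc m.
have K0 : 0 < K by move: K_ge3; clear; lia.
pose outer p := N (x p) :&: (N z :\: F).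
case: (boolP [forall p : 'I_K, (outer p == set0) || (outer p.+1 == set0)]) => [/forallP alt|].
  apply: (links_bound C) => p.
  have := alt (Ordinal (ltn_pmod p K0)); rewrite /outer /=.
  have -> : x (p %% K).+1 = x p.+1.
    by rewrite (cyc_x_mod C) -addn1 modnDml addn1 -(cyc_x_mod C).
  by rewrite -(cyc_x_mod C).
rewrite negb_forall => /existsP[p]; rewrite negb_or => /andP[/set0Pn[e ep] /set0Pn[e' ep']].
move: ep ep'; rewrite !inE => /and3P[ep eF ez] /and3P[e'p e'F e'z].
(* Different [e] and [e'] would allow [z] to be inserted between [x p] and [x p.+1]. *)
have [ee'|ee'] := eqVneq e e'; last first.
  by exfalso; apply: (cyc_no_insert C ep ez e'z e'p ee'); rewrite ?eF ?e'F orbT.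
rewrite -ee' in e'p.
have C' := cyc_replace C (ltn_ord p) eF ep e'p.
apply: IH (cyc_miss C').
have wp : w p \notin N z.
  apply: contra eF => wp; apply: (subsetP (cyc_sub_prev C wp)).
  by rewrite inE ez.
have -> : deg (e |: F :\ w p) z = (deg F z).+1.
  rewrite /deg; have -> : N z :&: (e |: F :\ w p) = e |: (N z :&: F).
    apply/setP => f; rewrite !inE; case: (f =P e) => [->|_] /=; first by rewrite ez.
    by case: (f =P w p) => [->|] //=; rewrite (negbTE wp).
  by rewrite cardsU1 inE (negbTE eF) andbF.
have := miss_deg_le3 (cyc_miss C'); have := cyc_deg_le C z.
have := cyc_not_near_full C; case: (leqP K (deg F z).+1) => [_ /(_ isT) //|].
by move: leK; clear; lia.
Qed.

(** * The final count with four vertices *)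

Hypothesis crit : forall z, z \in X -> exists F, miss F z.
Hypothesis common2 : forall x z, x \in X -> z \in X -> x != z ->
  exists2 e, e \in N x & e \in N z.
Hypothesis common3 : forall x z z' y, x \in X -> z \in X -> z' \in X ->
  x != z -> x != z' -> z != z' ->
  exists e, [/\ e != y, e \in N x & (e \in N z) || (e \in N z')].

(** If [H] had at most one edge, [common2] or [common3] would give an edge outside [H] from [z] to a
    vertex outside [B]. So [H] has two edges or more, which leaves at most one vertex for [B], and
    one only if [H] and [B] have three elements together, hence only if [8 <= K]. *)
Lemma few_links z : z \in X -> exists (H : {set E}) (B : {set V}),
  [/\ #|H| <= 3, #|B| <= (8 <= K)
    & forall v, v \in X -> v != z -> v \notin B -> N z :&: N v \subset H].
Proof.
move=> zX; have [F m] := crit zX; have [H [B [HB HB3 sub]]] := miss_links m.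
exists H, B; split=> //; first by apply: leq_trans HB; apply: leq_addr.
have K3 := K_ge3.
have cR : K <= #|X :\ z :\: B| + #|B|.
  have := cardsD1 z X; rewrite zX cardX add1n => -[->].
  by rewrite -(cardsID B (X :\ z)) addnC leq_add2l subset_leq_card // subsetIr.
have RP v : v \in X :\ z :\: B -> [/\ v \in X, v != z & N z :&: N v \subset H].
  by rewrite !inE => /and3P[vB vz vX]; split=> //; apply: sub.
have BK : #|H| <= 1 -> #|B| + #|H| < K.
  move: HB3 HB K3; move: #|H| #|B| => h b H1 H2 K3 h1.
  by case: (eqVneq (h + b) 3) => [/H1|/eqP]; move: H2 K3 h1; clear; lia.
suff H2 : 2 <= #|H|.
  move: HB HB3 H2; move: #|H| #|B| => h b HB HB3 H2.
  case: leqP => K8 /=; last by move: HB H2; clear; lia.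
  have : h + b <> 3 by move=> /HB3; move: K8; clear; lia.
  by move: HB H2; clear; lia.
rewrite ltnNge; apply/negP => H1.
have {BK} := BK H1; case: (posnP #|H|) => [H0|Hpos] BK.
  have [v vR] : exists v, v \in X :\ z :\: B.
    by apply/set0Pn; rewrite -card_gt0; move: cR BK H0; clear; lia.
  have [vX vz /subsetP sv] := RP v vR.
  have [|e ez ev] := common2 zX vX; first by rewrite eq_sym.
  have := sv e; rewrite inE ez ev => /(_ isT).
  by rewrite (cards0_eq H0) inE.
have /cards1P[h eH] : #|H| == 1 by rewrite eqn_leq H1.
have /card_gt1P[v [v' [vR v'R vv']]] : 1 < #|X :\ z :\: B|.
  by move: cR BK Hpos; clear; lia.
have [vX vz /subsetP sv] := RP v vR; have [v'X v'z /subsetP sv'] := RP v' v'R.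
have [||e [eh ez ev]] := common3 h zX vX v'X _ _ vv'; try by rewrite eq_sym.
have : e \in H by case/orP: ev => ev; [apply: sv | apply: sv']; rewrite inE ez.
by rewrite eH inE (negbTE eh).
Qed.

Lemma no_minimal_counterexample : False.
Proof.
have K3 := K_ge3.
(* Each choice excludes at most [1 + (8 <= K)] vertices, so three choices leave one of the [K.+1]
   vertices free; for [K < 8] this relies on there being no exceptional vertex. *)
have b1 : (8 <= K) * 3 + 3 <= K by case: leqP; move: K3; clear; lia.
have pick (A : {set V}) : #|A| < #|X| -> exists2 v, v \in X & v \notin A.
  move=> AX; apply/subsetPn; apply: contraL AX => /subset_leq_card.
  by rewrite -leqNgt.
have cU1 (v : V) (B A : {set V}) n b : #|B| <= b -> #|A| <= n -> #|v |: B :|: A| <= n + b.+1.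
  move=> Bb An; apply: leq_trans (leq_card_setU _ _) _.
  have : #|v |: B| <= 1 + #|B| by rewrite -(cards1 v) leq_card_setU.
  by move: Bb An; clear; lia.
have step (A : {set V}) n : #|A| <= n -> n <= K -> exists z (H : {set E}) (B : {set V}),
    [/\ z \in X, z \notin A, #|H| <= 3, #|z |: B :|: A| <= n + (8 <= K).+1
      & forall v, v \in X -> v \notin z |: B :|: A -> N z :&: N v \subset H].
  move=> An nK; have [|z zX zA] := pick A; first by rewrite cardX ltnS (leq_trans An).
  have [H [B [cH cB sub]]] := few_links zX.
  exists z, H, B; split=> //; first exact: cU1.
  by move=> v vX; rewrite !inE !negb_or => /andP[/andP[vz vB] _]; apply: sub.
have [z1 [H1 [B1 [z1X _ cH1 cA1 s1]]]] := @step set0 0 (eq_leq (cards0 _)) (leq0n _).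
set A1 := (_ |: _ :|: _) in cA1 s1.
have [|z2 [H2 [B2 [z2X z2A cH2 cA2 s2]]]] := step A1 _ cA1.
  by move: b1; clear; lia.
set A2 := (_ |: _ :|: _) in cA2 s2.
have [|z3 [H3 [B3 [z3X z3A cH3 cA3 s3]]]] := step A2 _ cA2.
  by move: b1; clear; lia.
set A3 := (_ |: _ :|: _) in cA3 s3.
have [|z4 [_ [_ [z4X z4A _ _ _]]]] := step A3 _ cA3.
  by move: b1; clear; lia.
have A12 v : v \notin A2 -> v \notin A1 by apply: contra => vA; apply/setUP; right.
have A23 v : v \notin A3 -> v \notin A2 by apply: contra => vA; apply/setUP; right.
have cU (D H : {set E}) v : v \in X -> #|H| <= 3 -> N v :&: D \subset H ->
    delta + #|D| <= #|N v :|: D| + 3.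
  move=> vX cH sub; have := cardsUI (N v) D; have := degX vX.
  by have := leq_trans (subset_leq_card sub) cH; clear; lia.
have u3 := cU (N z4) H3 z3 z3X cH3 (s3 _ z4X z4A).
have u2 : delta + #|N z3 :|: N z4| <= #|N z2 :|: (N z3 :|: N z4)| + 3.
  by apply: cU cH2 _ => //; rewrite setIUr subUset !s2 // A23.
have u1 : delta + #|N z2 :|: (N z3 :|: N z4)| <= #|N z1 :|: (N z2 :|: (N z3 :|: N z4))| + 3.
  by apply: cU cH1 _ => //; rewrite !setIUr !subUset !s1 // A12 // A23.
have : N z1 :|: (N z2 :|: (N z3 :|: N z4)) \subset Y by rewrite !subUset !NY.
move/subset_leq_card; have := degX z4X.
by move: u1 u2 u3 cardY; clear; lia.
Qed.

End Core.

(** * Hall's theorem for three sets *)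

(** That two of the sets have at least two elements together is stated as avoidance of any given
    [y], the form in which 2-connectivity supplies it. *)
Lemma distinct_representatives (E : finType) (A B C : {set E}) :
    2 < #|A :|: B :|: C| ->
    (forall y, exists2 e, e != y & e \in A :|: B) ->
    (forall y, exists2 e, e != y & e \in B :|: C) ->
    (forall y, exists2 e, e != y & e \in A :|: C) ->
    A != set0 -> B != set0 -> C != set0 ->
  exists a b c, [/\ a \in A, b \in B, c \in C & uniq [:: a; b; c]].
Proof.
move=> c3 AB BC AC A0 B0 C0.
have two (S T : {set E}) : (forall y, exists2 e, e != y & e \in S :|: T) ->
    S != set0 -> T != set0 -> exists s t, [/\ s \in S, t \in T & s != t].
  move=> ST /set0Pn[s sS] /set0Pn[t tT]; have [st|st] := eqVneq s t; last by exists s, t.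
  have [e es /setUP[eS|eT]] := ST s; first by exists e, t; rewrite -st in tT *.
  by exists s, e; rewrite eq_sym in es.
have [a [b [aA bB ab]]] := two _ _ AB A0 B0.
have [/subsetP Cab|/subsetPn[c cC]] := boolP (C \subset [set a; b]); last first.
  rewrite !inE negb_or => /andP[ca cb]; exists a, b, c; split=> //.
  by rewrite /= !inE negb_or ab (eq_sym a) ca (eq_sym b) cb.
(* Now [C] lies inside [{a, b}], so a third element [d] of the union comes from [A] or [B]. *)
have /subsetPn[d] : ~~ (A :|: B :|: C \subset [set a; b]).
  by apply: contraL c3 => /subset_leq_card; rewrite cards2 ab -leqNgt.
rewrite inE => /orP[|/Cab ->//] dAB; rewrite !inE negb_or => /andP[da db].
case/setUP: dAB => [dA|dB].
  have [aC|aC] := boolP (a \in C).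
    by exists d, b, a; rewrite /= !inE negb_or db da (eq_sym b) ab dA bB aC.
  have [b' [c [b'B cC b'c]]] := two _ _ BC B0 C0.
  have cb : c = b by have := Cab _ cC; rewrite !inE => /orP[/eqP e|/eqP//]; rewrite -e cC in aC.
  rewrite cb in cC b'c; have [b'a|b'a] := eqVneq b' a.
    by exists d, b', b; rewrite /= !inE negb_or b'a da db ab dA cC -b'a b'B.
  by exists a, b', b; rewrite /= !inE negb_or (eq_sym a) b'a ab b'c aA b'B cC.
have [bC|bC] := boolP (b \in C).
  by exists a, d, b; rewrite /= !inE negb_or (eq_sym a) da ab db aA dB bC.
have [a' [c [a'A cC a'c]]] := two _ _ AC A0 C0.
have ca : c = a by have := Cab _ cC; rewrite !inE => /orP[/eqP//|/eqP e]; rewrite -e cC in bC.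
rewrite ca in cC a'c; have [a'b|a'b] := eqVneq a' b.
  by exists a', d, a; rewrite /= !inE negb_or a'b (eq_sym b) db (eq_sym b) ab da -a'b a'A dB cC.
by exists a', b, a; rewrite /= !inE negb_or a'b a'c (eq_sym b) ab a'A bB cC.
Qed.

(** * Berge cycles as closed walks *)

Section BergeCycles.

Variables (V : finType) (H : hypergraph V).

Definition edges_at (v : V) : {set {set V}} := [set e in H | v \in e].

(** A boolean form, with the length fixed at [#|A|], so that the existence of a cycle can be proved
    by contradiction. *)
Definition base_of_cycle (A : {set V}) :=
  [exists v : {ffun 'I_#|A| -> V}, exists e : {ffun 'I_#|A| -> {set V}},
   [&& injectiveb v, injectiveb e,
       [forall i, [&& e i \in H, v i \in e i & v (ordS i) \in e i]]
     & [set v i | i : 'I_#|A|] == A]].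

Lemma base_of_cycleP (A : {set V}) :
  reflect (exists (l : nat) (v : 'I_l -> V) (e : 'I_l -> {set V}),
             berge_cycle H v e /\ [set v i | i : 'I_l] = A)
          (base_of_cycle A).
Proof.
apply: (iffP existsP) => [[v /existsP[e /and4P[/injectiveP iv /injectiveP ie /forallP inc /eqP im]]]|].
  by exists #|A|, v, e; split=> //; split=> // i; have /and3P[eH v1 v2] := inc i; rewrite ?v1.
case=> l [v [e [[iv ie eH inc] im]]].
have el : l = #|A| by rewrite -im card_imset // card_ord.
subst l; exists (finfun v); apply/existsP; exists (finfun e); apply/and4P; split.
- by apply/injectiveP => i j; rewrite !ffunE; apply: iv.
- by apply/injectiveP => i j; rewrite !ffunE; apply: ie.
- by apply/forallP => i; rewrite !ffunE eH; have := inc i.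
- by apply/eqP; rewrite -[RHS]im; apply: eq_imset => i; rewrite ffunE.
Qed.

Lemma base_of_closed_walk (A : {set V}) a b e vs es :
    walk edges_at a b vs es -> e \in edges_at a -> e \in edges_at b ->
    perm_eq vs (enum A) -> uniq (e :: es) -> base_of_cycle A.
Proof.
move=> W ea eb pv /= /andP[ees ues]; have [u [w [u0 un L pu pw]]] := walk_index e W.
set n := size es in un L pu pw.
have uu : uniq (map u (iota 0 n.+1)) by rewrite -(perm_uniq pu) (perm_uniq pv) enum_uniq.
have uw : uniq (map w (iota 0 n)) by rewrite -(perm_uniq pw).
apply/base_of_cycleP; exists n.+1, (fun i : 'I_n.+1 => u i).
exists (fun i : 'I_n.+1 => if i == n :> nat then e else w i); split.
  have wes i : i < n -> w i \in es by move=> iN; rewrite (perm_mem pw) map_f // mem_iota.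
  have ne (i : 'I_n.+1) : (i == n :> nat) = false -> i < n.
    by move=> ine; rewrite ltn_neqAle ine -ltnS ltn_ord.
  have lnk (i : 'I_n.+1) : let f := if i == n :> nat then e else w i in
      (f \in edges_at (u i)) && (f \in edges_at (u (ordS i))).
    rewrite /=; case: ifP => [/eqP i_n|/ne iN].
      by rewrite i_n modnn u0 un ea eb.
    by rewrite modn_small ?ltnS //; exact: L.
  split.
  - by move=> i j /= eu; apply/val_inj; apply: (uniq_iota_inj (n := n.+1)) eu; rewrite ?ltn_ord // /index_iota subn0.
  - move=> i j /=; case: ifP => [/eqP i_n|/ne iN]; case: ifP => [/eqP j_n|/ne jN].
    + by move=> _; apply/val_inj; rewrite /= i_n j_n.
    + by move=> ej; rewrite ej wes in ees.
    + by move=> ej; rewrite -ej wes in ees.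
    + by move=> ew; apply/val_inj; apply: (uniq_iota_inj (n := n)) ew; rewrite // /index_iota subn0.
  - by move=> i; have := lnk i; rewrite /= inE => /andP[/andP[]].
  - by move=> i; have := lnk i; rewrite /= !inE => /andP[/andP[_ ->] /andP[_ ->]].
apply/setP => x; rewrite -[RHS]mem_enum -(perm_mem pv) (perm_mem pu).
apply/imsetP/mapP => [[i _ ->]|[i]].
  by exists (i : nat) => //; rewrite mem_iota ltn_ord.
by rewrite mem_iota => /andP[_ iN] ->; exists (Ordinal (iN : i < n.+1)).
Qed.

Lemma closed_walk_of_base (A : {set V}) : 0 < #|A| -> base_of_cycle A ->
  exists (F : {set {set V}}) a b e vs es,
  [/\ walk edges_at a b vs es, e \in edges_at a, e \in edges_at b,
      perm_eq vs (enum A) & perm_eq (e :: es) (enum F)].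
Proof.
move=> A0 /base_of_cycleP[l [v [e [[iv ie eH inc] im]]]].
have el : l = #|A| by rewrite -im card_imset // card_ord.
rewrite -el in A0; case: l A0 v e iv ie eH inc im {el} => // n _ v e iv ie eH inc im.
pose u i := v (inord i); pose w i := e (inord i).
have winc i : (w i \in edges_at (u i)) && (w i \in edges_at (v (ordS (inord i)))).
  by rewrite !inE eH; have := inc (inord i).
have oS i : i < n -> ordS (inord i : 'I_n.+1) = inord i.+1.
  by move=> iN; apply/val_inj; rewrite /= !inordK ?modn_small // ltnS ltnW.
have uu : uniq (map u (index_iota 0 n.+1)).
  rewrite map_inj_in_uniq ?iota_uniq // => i j; rewrite !mem_index_iota => iN jN /iv.
  by move/(congr1 val); rewrite /= !inordK.
have uw : uniq (map w (index_iota 0 n.+1)).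
  rewrite map_inj_in_uniq ?iota_uniq // => i j; rewrite !mem_index_iota => iN jN /ie.
  by move/(congr1 val); rewrite /= !inordK.
exists [set f in map w (index_iota 0 n.+1)], (u 0), (u n), (w n).
exists (map u (index_iota 0 n.+1)), (map w (index_iota 0 n)); split.
- apply: walk_seg => // i /andP[_ iN]; have /andP[-> ] := winc i.
  by rewrite oS.
- have /andP[_] := winc n; rewrite (_ : ordS _ = inord 0) //.
  by apply/val_inj; rewrite /= !inordK ?modnn.
- by have /andP[] := winc n.
- apply: uniq_perm; rewrite ?enum_uniq // => x; rewrite mem_enum -im.
  apply/mapP/imsetP => [[i _ ->]|[i _ ->]]; first by exists (inord i).
  by exists (i : nat); rewrite ?mem_index_iota ?ltn_ord // /u inord_val.
- apply: perm_trans (perm_enum_set uw).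
  by rewrite (@index_iota_cat 0 n n.+1) ?leqnSn // index_iota1; perm_count.
Qed.

End BergeCycles.

(** * What the conditions on the incidence graph give *)

Section Incidence.

Variables (V : finType) (H : hypergraph V).

Let G := incidence_graph H.
Let hat (A : {set V}) := super_neighborhood G (incidence_Y H) (inl @: A).

Lemma hatP (A : {set V}) (e : edge_type H) :
  (inr e \in hat A) = (1 < #|[set v in A | v \in val e]|).
Proof.
rewrite inE; have -> : inr e \in incidence_Y H by apply/imsetP; exists e.
rewrite /= -(card_imset _ (@inl_inj V (edge_type H))); congr (_ < _).
apply: eq_card => -[v|f]; rewrite !inE /=.
  by rewrite !(mem_imset _ _ (@inl_inj _ _)) inE andbC.
by rewrite /=; apply/idP/imsetP => [//|[]].
Qed.

Lemma card_hat (A : {set V}) : #|hat A| <= #|shared (edges_at H) A|.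
Proof.
pose f (y : incidence_vertex H) := if y is inr e then val e else set0.
have hatY y : y \in hat A -> exists e, y = inr e.
  by rewrite inE => /andP[/imsetP[e _ ->] _]; exists e.
have finj : {in hat A &, injective f}.
  by move=> _ _ /hatY[e ->] /hatY[e' ->] /= /val_inj ->.
rewrite -(card_in_imset finj); apply: subset_leq_card; apply/subsetP => _ /imsetP[y yA ->].
have [e ye] := hatY y yA; move: yA; rewrite ye hatP inE /=; congr (1 < _).
by apply: eq_card => v; rewrite !inE (valP e).
Qed.

(** Deleting the node [g], a vertex or an edge, leaves [x] and [z] connected. If there were no such
    edge, [x] together with the edges at [x], whose indicator is [h], would be closed under
    adjacency and separate [x] from [z]. *)
Lemma common_edge (A : {set V}) g x z :
    k_connected 2 (induced G (inl @: A :|: hat A)) ->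
    x \in A -> z \in A -> x != z -> inl x != g -> inl z != g ->
  exists e : edge_type H, [/\ inr e != g, x \in val e
    & exists2 z', [&& z' \in A, z' != x & inl z' != g] & z' \in val e].
Proof.
set S := _ :|: hat A => -[_ conn] xA zA xz xg zg.
pose W := [set y : {y | y \in S} | val y == g].
have W2 : #|W| < 2.
  rewrite ltnS; apply/card_le1_eqP => p q; rewrite !inE => /eqP pg /eqP qg.
  by apply/val_inj; rewrite pg qg.
have [_ {}conn] := conn W W2.
have inS v : v \in A -> inl v \in S by move=> vA; rewrite inE imset_f.
have inW (y : {y | y \in S}) : val y != g -> y \in ~: W by rewrite !inE.
pose xS : {y | y \in S} := exist (fun y => y \in S) _ (inS _ xA).
pose zS : {y | y \in S} := exist (fun y => y \in S) _ (inS _ zA).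
pose xW : {y | y \in ~: W} := exist (fun y => y \in ~: W) xS (inW xS xg).
pose zW : {y | y \in ~: W} := exist (fun y => y \in ~: W) zS (inW zS zg).
have [/existsP[e /and3P[eg xe /existsP[z' /and4P[z'A z'x z'g z'e]]]]|none] :=
    boolP [exists e : edge_type H, [&& inr e != g, x \in val e &
      [exists z', [&& z' \in A, z' != x, inl z' != g & z' \in val e]]]].
  by exists e; split=> //; exists z'; rewrite ?z'A ?z'x.
pose h (y : incidence_vertex H) := match y with inl v => v == x | inr e => x \in val e end.
have edge (v : V) (e : edge_type H) : inl v \in S -> inl v != g -> inr e != g ->
    v \in val e -> (v == x) = (x \in val e).
  move=> vS vg eg ve; have [<-|vx] := eqVneq v x; first by rewrite ve.
  apply/esym/negbTE; apply: contra none => xe; apply/existsP; exists e.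
  rewrite eg xe /=; apply/existsP; exists v; rewrite vx vg ve !andbT.
  case/setUP: vS => [/imsetP[v' v'A [->]] //|].
  by rewrite inE => /andP[/imsetP[]].
have nW (y : {y | y \in ~: W}) : val (val y) != g by have := valP y; rewrite !inE.
have key y y' : y \in S -> y' \in S -> y != g -> y' != g -> G y y' -> h y = h y'.
  case: y => [v|e] yS; case: y' => [v'|e'] y'S yg y'g //= inc; first exact: edge.
  by apply/esym; apply: edge.
have cl : closed (induced (induced G S) (~: W)) [pred y | h (val (val y))].
  by move=> p q inc; apply: key => //; [apply: (valP (val p)) | apply: (valP (val q))].
have := closed_connect cl (conn xW zW).
by rewrite !inE /= eqxx eq_sym (negbTE xz).
Qed.

End Incidence.

(** * Induction on the size of the base set *)

Section AllBaseSets.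

Variables (V : finType) (H : hypergraph V) (delta : nat).
Let N := edges_at H.
Hypothesis min_degree : forall v, delta <= #|N v|.
Hypothesis V_le_delta : #|V| <= delta.
Hypothesis H_le_delta : #|H| + 10 <= 4 * delta.
Hypothesis many_shared : forall A : {set V}, 3 <= #|A| -> #|A| <= #|shared N A|.
Hypothesis pair_common : forall x z c, x != z -> x != c -> z != c ->
  exists2 e, e \in N x & e \in N z.
Hypothesis triple_common : forall x z z' y, x != z -> x != z' -> z != z' ->
  exists e, [/\ e != y, e \in N x & (e \in N z) || (e \in N z')].

(** Hall's theorem for the common edges of the three pairs: (i) provides three edges in the union of
    all, [triple_common] two in the union of any two, [pair_common] one in each. *)
Lemma base_of_triangle a b c : a != b -> a != c -> b != c ->
  base_of_cycle H [set a; b; c].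
Proof.
move=> ab ac bc; have ba := ab; have ca := ac; have cb := bc.
rewrite eq_sym in ba; rewrite eq_sym in ca; rewrite eq_sym in cb.
have c3 : #|[set a; b; c]| = 3.
  by rewrite setUC cardsU1 !inE negb_or ca cb cards2 ab.
have shared3 : 2 < #|(N a :&: N b) :|: (N b :&: N c) :|: (N a :&: N c)|.
  have := many_shared (eq_leq (esym c3)); rewrite c3 => le; apply: leq_trans le _.
  apply: subset_leq_card; apply/subsetP => e /sharedP[v [v' []]].
  rewrite !inE -!orbA.
  by case/or3P=> /eqP-> /or3P[]/eqP->; rewrite ?eqxx // => _ -> ->; rewrite ?orbT.
have avoid u v v' y : u != v -> u != v' -> v != v' ->
    exists2 e, e != y & e \in (N u :&: N v) :|: (N u :&: N v').
  move=> uv uv' vv'; have [e [ey eu ev]] := triple_common y uv uv' vv'.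
  by exists e => //; rewrite -setIUr inE eu inE.
have nonempty u v v' : u != v -> u != v' -> v != v' -> N u :&: N v != set0.
  move=> uv uv' vv'; have [e eu ev] := pair_common uv uv' vv'.
  by apply/set0Pn; exists e; rewrite inE eu.
have [y|y|y||||p [q [r [pA qB rC u]]]] := distinct_representatives shared3.
- by rewrite setIC; apply: avoid.
- by rewrite setUC [N b :&: N c]setIC (setIC (N a)); apply: avoid.
- exact: avoid.
- exact: nonempty ab ac bc.
- exact: (nonempty b c a).
- exact: (nonempty a c b).
case/setIP: pA => pa pb; case/setIP: qB => qb qc; case/setIP: rC => ra rc.
have W := walk_cat (walk_nil N a) (walk_cat (walk_nil N b) (walk_nil N c) qb qc) pa pb.
apply: base_of_closed_walk W ra rc _ _; last first.
  by rewrite -(perm_uniq (_ : perm_eq [:: p; q; r] _)) //; perm_count.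
by apply: uniq_perm; rewrite ?enum_uniq //= ?inE ?negb_or ?ab ?ac ?bc // => v; rewrite mem_enum !inE orbA.
Qed.

Lemma base_of_every_set (A : {set V}) : 3 <= #|A| -> base_of_cycle H A.
Proof.
have [n] := ubnP #|A|; elim: n A => // n IH A An A3.
have [A4|A4] := ltnP 3 #|A|; last first.
  have /card_gt0P[a aA] : 0 < #|A| by apply: leq_trans A3.
  have /cards2P[b [c [bc eA]]] : #|A :\ a| == 2.
    by have := cardsD1 a A; rewrite aA; move: A3 A4; clear; lia.
  have neq v : v \in [set b; c] -> a != v by rewrite -eA !inE eq_sym => /andP[].
  rewrite -(setD1K aA) eA setUA; apply: base_of_triangle => //; apply: neq.
    by rewrite !inE eqxx.
  by rewrite !inE eqxx orbT.
apply: contraT => nA; exfalso.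
(* [pair_common] is applied to a triple, whose third vertex is supplied here. *)
have third u v : exists2 c, c \in A & (u != c) && (v != c).
  have /subsetPn[c cA] : ~~ (A \subset [set u; v]).
    apply: contraL A3 => /subset_leq_card; rewrite cards2 -leqNgt => le.
    by apply: leq_trans le _; case: (u == v).
  by rewrite !inE negb_or ![c == _]eq_sym; exists c.
apply: (@no_minimal_counterexample V _ N A H #|A|.-1 delta) => //.
- by rewrite prednK //; apply: leq_trans A3.
- by move: A4; clear; lia.
- by move=> v; apply/subsetP => e; rewrite inE => /andP[].
- have AV : #|A| <= #|V| by apply: max_card.
  by move: AV V_le_delta A4; clear; lia.
- move=> F a b e h ea eb; apply: contraT => eF; case/negP: nA.
  by apply: base_of_closed_walk h ea eb _ _ => //=; rewrite mem_enum eF enum_uniq.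
- by move=> B _; apply: many_shared.
- move=> z zA; have cz : #|A| = (#|A :\ z|).+1 by rewrite (cardsD1 z) zA.
  have bz : base_of_cycle H (A :\ z) by apply: IH; move: An A4; rewrite cz; clear; lia.
  have [|F [a [b [e [vs [es [W ea eb pv pe]]]]]]] := closed_walk_of_base _ bz.
    by move: A4; rewrite cz; clear; lia.
  exists F, a, b, e, vs, es; split=> //.
  apply: (@perm_trans _ (z :: enum (A :\ z))); first by rewrite perm_cons.
  apply: uniq_perm; rewrite ?enum_uniq //=; first by rewrite mem_enum !inE eqxx enum_uniq.
  by move=> v; rewrite inE !mem_enum !inE; case: eqP => [->|].
- move=> x z _ _ xz; have [c _ /andP[xc zc]] := third x z.
  exact: pair_common xz xc zc.
- by move=> x z z' y _ _ _; apply: triple_common.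
Qed.

End AllBaseSets.

Theorem corollary1p9 (V : finType) (H : hypergraph V) (n m delta : nat)
    (hn : #|V| = n) (hm : #|H| = m) (n_ge2 : 2 <= n)
    (min_degree : forall v : V, delta <= degree H v)
    (delta_gt0 : 0 < delta)
    (delta_ge : (Num.max n%:R ((m%:R + 10%:R) / 4%:R) <= delta%:R :> rat)%R)
    (super_nbhd : forall A : {set incidence_vertex H},
       A \subset incidence_X H -> 3 <= #|A| ->
       #|A| <= #|super_neighborhood (incidence_graph H) (incidence_Y H) A| /\
       k_connected 2 (induced (incidence_graph H)
         (A :|: super_neighborhood (incidence_graph H) (incidence_Y H) A))) :
  super_pancyclic H.
Proof.
have inX (A : {set V}) : inl @: A \subset incidence_X H.
  by apply/subsetP => _ /imsetP[v _ ->]; apply: imset_f.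
have cA (A : {set V}) : #|inl @: A : {set incidence_vertex H}| = #|A|.
  exact/card_imset/inl_inj.
have nbhd (A : {set V}) (A3 : 3 <= #|A|) := super_nbhd _ (inX A) (etrans (congr1 _ (cA A)) A3).
have three (x z c : V) : x != z -> x != c -> z != c -> 3 <= #|[set x; z; c]|.
  move=> xz xc zc; rewrite setUC cardsU1 !inE negb_or cards2 xz.
  by rewrite (eq_sym c) xc (eq_sym c) zc.
have [nd md] : n <= delta /\ m + 10 <= 4 * delta.
  move: delta_ge; rewrite Order.TotalTheory.ge_max => /andP[h1 h2].
  split; first by rewrite -(Num.Theory.ler_nat rat).
  move: h2; rewrite Num.Theory.ler_pdivrMr ?Num.Theory.ltr0n //.
  by rewrite -GRing.natrD -GRing.natrM Num.Theory.ler_nat mulnC.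
move=> A A3; apply/base_of_cycleP; apply: (@base_of_every_set V H delta) => //.
- by rewrite hn.
- by rewrite hm.
- by move=> B B3; have [le _] := nbhd B B3; rewrite cA in le; apply: leq_trans le (card_hat _ _).
(* With [c] deleted from the triple, [z] is the only vertex left with which [x] can share an
   edge. *)
- move=> x z c xz xc zc; have [_ k2] := nbhd _ (three _ _ _ xz xc zc).
  have [||||| e [_ xe [z' /and3P[z'A z'x z'c] z'e]]] := @common_edge _ _ _ (inl c) x z k2.
  + by rewrite !inE eqxx.
  + by rewrite !inE eqxx orbT.
  + by [].
  + by rewrite (inj_eq (@inl_inj _ _)).
  + by rewrite (inj_eq (@inl_inj _ _)).
  rewrite (inj_eq (@inl_inj _ _)) in z'c.
  move: z'A; rewrite !inE (negbTE z'x) (negbTE z'c) orbF /= => /eqP z'z.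
  by exists (val e); rewrite inE (valP e) // -z'z.
- move=> x z z' y xz xz' zz'; have [_ k2] := nbhd _ (three _ _ _ xz xz' zz').
  have xA : x \in [set x; z; z'] by rewrite !inE eqxx.
  have zA : z \in [set x; z; z'] by rewrite !inE eqxx orbT.
  (* If [y] is an edge, it is the deleted node; otherwise every edge differs from [y], and [z'] is
     deleted instead. *)
  have [yH|yH] := boolP (y \in H).
    pose g : incidence_vertex H := inr (exist (fun e => e \in H) y yH).
    have [|| e [ey xe [v /and3P[vA vx _] ve]]] := @common_edge _ _ _ g x z k2 xA zA xz; try by [].
    exists (val e); split; last first.
    + by move: vA ve; rewrite !inE (negbTE vx) (valP e) /= => /orP[]/eqP-> ->; rewrite ?orbT.
    + by rewrite inE (valP e).
    + by apply: contra ey => /eqP ey; apply/eqP; congr inr; apply/val_inj.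
  have [|| e [_ xe [v /and3P[vA vx _] ve]]] := @common_edge _ _ _ (inl z') x z k2 xA zA xz.
  + by rewrite (inj_eq (@inl_inj _ _)).
  + by rewrite (inj_eq (@inl_inj _ _)).
  exists (val e); split; last first.
  + by move: vA ve; rewrite !inE (negbTE vx) (valP e) /= => /orP[]/eqP-> ->; rewrite ?orbT.
  + by rewrite inE (valP e).
  + by apply: contraNneq yH => <-; apply: valP.
Qed.
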